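(* There is an algorithm that, given two non-empty sums of cycles $A,B$, computes the number of sums of cycles $X$ (up to isomorphism) satisfying $AX=B$, with time complexity in $$O\left(|B|^3\left(\frac{|B|}{|A|}\right)^{\operatorname{div}(\operatorname{lcm} L(A))}\right).$$
   Context: A sum of cycles is a finite digraph that is a disjoint union of directed cycles, considered up to isomorphism ($A=B$ means $A$ is isomorphic to $B$). $C_\ell$ is the directed cycle of length $\ell\ge 1$, $A(\ell)$ is the number of cycles of length $\ell$ in $A$, $|A|=\sum_{\ell\ge1}\ell A(\ell)$ is the number of vertices of $A$, and $L(A)=\{\ell : A(\ell)>0\}$. The sum $A+B$ is disjoint union. The product $AB$ is the direct product of digraphs (arcs $(a,b)\to(a',b')$ where $a\to a'$ in $A$, $b\to b'$ in $B$); equivalently it is distributive with $C_aC_b=\gcd(a,b)\,C_{\operatorname{lcm}(a,b)}$, where $nC_\ell$ denotes $n$ disjoint copies of $C_\ell$. For a finite set $N$ of positive integers, $\operatorname{lcm}N$ is the least common multiple of its elements, and $\operatorname{div}(n)$ is the number of positive divisors of $n$. The size of the input $(A,B)$ is $|A|+|B|$ (digraphs are given explicitly).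
   Formalization: The displayed time bound is required only when |A| ≤ |B|; when |A| > |B| (no solution exists and the displayed bound can drop below one step, e.g. B=C_1, A=nC_1) the algorithm must still be correct but only run in time O(|A|+|B|). *)

(* Defs.v *)
From mathcomp Require Import all_boot all_order all_algebra.

Set Implicit Arguments.
Unset Strict Implicit.
Unset Printing Implicit Defensive.

Record digraph : Type := Digraph { vertex :> finType; darc : rel vertex }.

Definition dsize (G : digraph) : nat := #|vertex G|.

Definition diso (G H : digraph) : Prop :=
  exists2 f : G -> H, bijective f & forall x y, darc (f x) (f y) = darc x y.

Definition dempty : digraph := @Digraph void (fun _ _ => false).

Definition dsum (G H : digraph) : digraph :=
  @Digraph (vertex G + vertex H)%type (fun x y =>
    match x, y with
    | inl a, inl b => darc a b
    | inr a, inr b => darc a b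
    | _, _ => false
    end).

Definition dprod (G H : digraph) : digraph :=
  @Digraph (vertex G * vertex H)%type
    (fun x y => darc x.1 y.1 && darc x.2 y.2).

(* For l = 1 this is a single vertex with a loop; l = 0 is excluded wherever
   dcycle is used. *)
Definition dcycle (l : nat) : digraph :=
  @Digraph 'I_l (fun i j => (j : nat) == i.+1 %% l).

Definition sum_of_cycles (G : digraph) : Prop :=
  exists2 s : seq nat, all (leq 1) s &
    diso G (foldr (fun l H => dsum (dcycle l) H) dempty s).

(* The number G(l), for l > 0, of directed cycles of length l in G, a cycle
   being identified with its set of vertices; this identification is exact in
   a sum of cycles, where distinct cycles are vertex-disjoint. *)
Definition ncycles (G : digraph) (l : nat) : nat :=
  #|[set S : {set G} | [exists c : l.-tuple G,
       ucycleb (@darc G) c && (S == [set x in c])]]|.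

(* L(G): a directed cycle has at most dsize G vertices. *)
Definition cycle_lengths (G : digraph) : seq nat :=
  [seq l <- iota 1 (dsize G) | 0 < ncycles G l].

Definition lcm_seq (s : seq nat) : nat := \big[lcmn/1]_(l <- s) l.

Definition ndiv (n : nat) : nat := size (divisors n).

Definition solution (A B X : digraph) : Prop :=
  sum_of_cycles X /\ diso (dprod A X) B.

(* There are exactly k isomorphism classes of solutions: the family Xs is a
   transversal of them. *)
Definition number_of_solutions (A B : digraph) (k : nat) : Prop :=
  exists Xs : 'I_k -> digraph,
    [/\ forall i, solution A B (Xs i),
        forall i j, diso (Xs i) (Xs j) -> i = j
      & forall Y, solution A B Y -> exists i, diso Y (Xs i)].

(* The model of computation is the random access machine with the uniform cost
   criterion: registers and memory cells hold natural numbers, and every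
   instruction takes one unit of time. Addition and truncated subtraction are
   the only arithmetic operations; in particular there is no unit-cost
   multiplication or division. *)
Inductive instr : Type :=
| IConst (r k : nat)    (* R[r] := k *)
| IAdd (r s t : nat)    (* R[r] := R[s] + R[t] *)
| ISub (r s t : nat)    (* R[r] := R[s] - R[t], or 0 if R[s] < R[t] *)
| IRead (r s : nat)      (* R[r] := M[R[s]] *)
| IWrite (r s : nat)    (* M[R[r]] := R[s] *)
| IJz (r l : nat).       (* if R[r] = 0 then go to instruction l *)

Definition program : Type := seq instr.

Record state : Type :=
  State { pc : nat; regs : nat -> nat; cells : nat -> nat }.

Definition exec (i : instr) (q : state) : state :=
  let: State n R M := q in
  match i with
  | IConst r k => State n.+1 [eta R with r |-> k] M
  | IAdd r s t => State n.+1 [eta R with r |-> R s + R t] M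
  | ISub r s t => State n.+1 [eta R with r |-> R s - R t] M
  | IRead r s => State n.+1 [eta R with r |-> M (R s)] M
  | IWrite r s => State n.+1 R [eta M with R r |-> R s]
  | IJz r l => State (if R r == 0 then l else n.+1) R M
  end.

(* The machine halts (None) when the program counter leaves the program. *)
Definition step (p : program) (q : state) : option state :=
  omap (fun i => exec i q) (onth p (pc q)).

(* Started in q, the program halts after exactly t instructions, leaving the
   result k in R[0]. *)
Definition run (p : program) (q : state) (t k : nat) : Prop :=
  exists q', [/\ iter t (obind (step p)) (Some q) = Some q',
                 step p q' = None & regs q' 0 = k].

(* An explicit presentation of a digraph in which every vertex has exactly one
   out-neighbor: the vertices are numbered 0, ..., dsize G - 1 by e, in an
   arbitrary way, and u lists the out-neighbor of each of them. *)
Definition encodes (G : digraph) (u : seq nat) : Prop :=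
  size u = dsize G /\
  exists2 e : G -> 'I_(dsize G), bijective e &
    forall x y, darc x y = (nth 0 u (e x) == e y).

(* The two tables are stored consecutively from address 0, and their lengths
   are in R[0] and R[1]; all the other registers and cells contain 0. *)
Definition input (u v : seq nat) : state :=
  State 0 (nth 0 [:: size u; size v]) (nth 0 (u ++ v)).

(* Main.v *)
Require Import Defs.
From mathcomp Require Import all_boot all_order all_algebra zify.
Set Implicit Arguments.
Unset Strict Implicit.
Unset Printing Implicit Defensive.

(** Everything is counted in vertices. For a permutation f let N_f(l) be the
    number of points of order l, which is l times the number of cycles of
    length l. Two permutations are conjugate as soon as these functions agree
    (norder_conj_exists), and the order of a pair is the lcm of the orders, so
    that N_AX(k) is the sum of N_A(a) N_X(x) over the pairs with
    lcm(a, x) = k, without the gcd coefficients that appear when cycles are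
    counted (norder_prod). Let q be the integer part of |B| / |A|. Up to
    isomorphism, the solutions of AX = B are the vectors d, where d(x) is the
    number of cycles of length x <= q in X and x d(x) <= q, that satisfy one
    linear equation for each k <= |B| (number_of_solutionsE).

    The unknown d(x) occurs only in the equations at lcm(a, x) for a in L(A).
    Label the integers up to |B|, and merge the labels of x and lcm(a, x) for
    all a in L(A) and x <= q. The system splits into independent systems, one
    for each label, and the number of solutions is the product of theirs
    (card_solutions). Let L be the lcm of L(A). As a divides L,
    lcm(lcm(a, x), L) = lcm(x, L), so integers with the same label have the
    same lcm with L. Among these, x is determined by gcd(x, L), because
    x L = gcd(x, L) lcm(x, L), and gcd(x, L) is a divisor of L: at most div(L)
    unknowns share a label (count_lcm_class). The unknown d(x) takes at most
    q / x + 1 values, which is at most q except for x = 1, so that each system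
    has at most 2 q^div(L) candidates (weight_radix_le). The number L may be
    far too large to be computed with additions; it occurs in the analysis
    only, whereas the merging needs nothing but lcm(a, x) <= |A| q <= |B|.

    For each label an odometer runs through the candidates. Testing one of them
    takes a pass over the |A| q <= |B| pairs of a vertex of A and a length
    x <= q. Each lcm is found with O(|A| + q) additions, so that a test costs
    O(|B|^2). With |B| + 1 labels the total is O(|B|^3 q^div(L)), which
    dominates the tabulation of the orders and the merging.

    The algorithm is written in a language of bounded loops. Its semantics and
    its cost are total functions, and its compiler produces machine code that
    runs for exactly that cost (code_cmdP, run_compile). The result and the
    cost of the program are then established together, block after block
    (triple, mainP). *)

(** * Permutations counted by the orders of their points *)

Lemma eq_dvdn a b : (forall k, (a %| k) = (b %| k)) -> a = b.
Proof. by move=> e; apply/eqP; rewrite eqn_dvd e dvdnn -e dvdnn. Qed.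

Section Orders.
Variables (T : finType) (f : T -> T).
Hypothesis injf : injective f.

Lemma iter_mod_order k x : iter k f x = iter (k %% order f x) f x.
Proof.
rewrite {1}(divn_eq k (order f x)) addnC iterD; congr (iter _ f _).
by elim: (k %/ _) => // i IH; rewrite mulSn iterD IH iter_order.
Qed.

Lemma findex_iter_mod k x : findex f x (iter k f x) = k %% order f x.
Proof. by rewrite iter_mod_order findex_iter // ltn_mod order_gt0. Qed.

Lemma iter_fix_order k x : (iter k f x == x) = (order f x %| k).
Proof.
apply/eqP/idP => [e|/eqP e]; last by rewrite iter_mod_order e.
by rewrite /dvdn -findex_iter_mod e findex0.
Qed.

End Orders.

Lemma order_conj (T U : finType) (f : T -> T) (g : U -> U) (h : T -> U) x :
  injective f -> injective g -> injective h ->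
  (forall y, h (f y) = g (h y)) -> order g (h x) = order f x.
Proof.
move=> injf injg injh hf; apply: eq_dvdn => k.
rewrite -!iter_fix_order // -(inj_eq injh).
by congr (_ == _); elim: k => //= k ->; rewrite hf.
Qed.

Definition prodf (T U : Type) (f : T -> T) (g : U -> U) (p : T * U) :=
  (f p.1, g p.2).

Lemma prodf_inj (T U : Type) (f : T -> T) (g : U -> U) :
  injective f -> injective g -> injective (prodf f g).
Proof. by move=> injf injg [x y] [x' y'] [/injf-> /injg->]. Qed.

Lemma order_prod (T U : finType) (f : T -> T) (g : U -> U) x y :
  injective f -> injective g ->
  order (prodf f g) (x, y) = lcmn (order f x) (order g y).
Proof.
move=> injf injg; apply: eq_dvdn => k.
rewrite -iter_fix_order; last exact: prodf_inj.
rewrite dvdn_lcm -!iter_fix_order //.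
suff -> : iter k (prodf f g) (x, y) = (iter k f x, iter k g y) by [].
by elim: k => //= k ->.
Qed.

(** The number of vertices, rather than of cycles, is what the product
    convolves without gcd coefficients. *)
Definition norder (T : finType) (f : T -> T) (l : nat) :=
  #|[set x | order f x == l]|.

Lemma norder_sum (T : finType) (f : T -> T) l :
  norder f l = \sum_x (order f x == l).
Proof. by rewrite /norder -sum1dep_card big_mkcond. Qed.

Lemma norder_conj (T U : finType) (f : T -> T) (g : U -> U) (h : T -> U) l :
  injective f -> injective g -> bijective h ->
  (forall y, h (f y) = g (h y)) -> norder g l = norder f l.
Proof.
move=> injf injg bijh hf; rewrite !norder_sum.
rewrite (reindex h); last exact: onW_bij.
by apply: eq_bigr => x _; rewrite (order_conj _ injf injg (bij_inj bijh) hf).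
Qed.

Lemma order_le_card (T : finType) (f : T -> T) x : order f x <= #|T|.
Proof. exact: max_card. Qed.

(** The order of a pair is the lcm of the orders; the pairs are grouped by the
    order of their second component. *)
Lemma norder_prod (T U : finType) (f : T -> T) (g : U -> U) q k :
  injective f -> injective g -> (forall y, order g y <= q) ->
  norder (prodf f g) k =
    \sum_x \sum_(i < q) (lcmn (order f x) i.+1 == k) * norder g i.+1.
Proof.
move=> injf injg le_q; rewrite norder_sum.
transitivity (\sum_x \sum_y (order (prodf f g) (x, y) == k)).
  by rewrite pair_bigA; apply: eq_bigr => -[].
apply: eq_bigr => x _.
under [RHS]eq_bigr do rewrite norder_sum big_distrr /=.
rewrite exchange_big /=; apply: eq_bigr => y _; rewrite order_prod //.
have lt_y : (order g y).-1 < q by rewrite orderSpred.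
rewrite (bigD1 (Ordinal lt_y)) //= orderSpred eqxx muln1 big1 ?addn0 // => i.
by rewrite -val_eqE /= -eqSS orderSpred eq_sym => /negPf ->; rewrite muln0.
Qed.

Lemma froot_iter (T : finType) (f : T -> T) k x :
  injective f -> froot f (iter k f x) = froot f x.
Proof.
move=> injf; apply/eqP; rewrite eq_sym root_connect ?fconnect_iter //.
exact: fconnect_sym.
Qed.

Section Conjugacy.
Variables (T U : finType) (f : T -> T) (g : U -> U).
Hypotheses (injf : injective f) (injg : injective g).
Hypothesis eqN : forall l, norder f l = norder g l.

Let roots (V : finType) (h : V -> V) (l : nat) :=
  [seq x <- enum V | froots h x && (order h x == l)].

Let rootsP (V : finType) (h : V -> V) (l : nat) x :
  (x \in roots h l) = froots h x && (order h x == l).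
Proof. by rewrite mem_filter mem_enum andbT. Qed.

Lemma size_roots (V : finType) (h : V -> V) l : injective h ->
  size (roots h l) * l = norder h l.
Proof.
move=> injh; rewrite /norder -(fcard_order_set injh (n := l)); last first.
- apply: intro_closed; first exact: fconnect_sym.
  move=> x _ /eqP <-; rewrite !inE => /eqP <-; apply/eqP.
  exact: (order_conj x injh injh injh).
- by apply/subsetP => x; rewrite !inE.
congr (_ * _); rewrite /roots size_filter /n_comp_mem cardE size_filter.
rewrite enumT; apply: eq_count => x /=; by rewrite !inE.
Qed.

(** The cycles of length l on the two sides are equinumerous, so their roots
    can be paired off; h sends the i-th iterate of a root to the i-th iterate
    of its partner. *)
Lemma conj_exists : exists2 h : T -> U,
  injective h & forall x, h (f x) = g (h x).
Proof.
(* As soon as T has a point so has U, which gives a default value to nth. *)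
have [x0|T0] := pickP (@predT T); last first.
  have noT (x : T) : False by have := T0 x.
  by exists (fun x => False_rect U (noT x)) => x; case: (noT x).
move=> _; have [y0 _|U0] := pickP (@predT U); last first.
  have := eqN (order f x0); rewrite /norder [X in _ = X]eq_card0 => [|y].
    by move/eqP; rewrite cards_eq0 => /eqP /setP /(_ x0); rewrite !inE eqxx.
  by have := U0 y.
have szE l : size (roots f l) = size (roots g l).
  case: l => [|l]; last first.
    by apply/eqP; rewrite -(eqn_pmul2r (ltn0Sn l)) !size_roots // eqN.
  have r0 (V : finType) (h : V -> V) : size (roots h 0) = 0.
    apply/eqP; rewrite size_filter eqn0Ngt -has_count; apply/hasPn => x _.
    by rewrite negb_and orbC -lt0n order_gt0.
  by rewrite !r0.
pose phi r := nth y0 (roots g (order f r)) (index r (roots f (order f r))).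
have phiP r : froots f r -> froots g (phi r) && (order g (phi r) == order f r).
  by move=> rr; rewrite -rootsP mem_nth // -szE index_mem rootsP rr eqxx.
have froot_f x : froots f (froot f x).
  by apply: roots_root; exact: fconnect_sym.
have con x : fconnect f (froot f x) x.
  by rewrite fconnect_sym // connect_root.
pose h x := iter (findex f (froot f x) x) g (phi (froot f x)).
have hiter k r : froots f r -> h (iter k f r) = iter k g (phi r).
  move=> rr; have /andP [_ /eqP o] := phiP r rr.
  by rewrite /h froot_iter // (eqP rr) findex_iter_mod // -o -iter_mod_order.
exists h => [x y|x]; last first.
  by rewrite -{1}(iter_findex (con x)) -iterS hiter.
move=> exy.
have er z : froot g (h z) = phi (froot f z).
  have /andP [/eqP gr _] := phiP _ (froot_f z).
  by rewrite /h froot_iter.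
have ephi : phi (froot f x) = phi (froot f y) by rewrite -!er exy.
have eo : order f (froot f x) = order f (froot f y).
  have /andP [_ /eqP <-] := phiP _ (froot_f x).
  by have /andP [_ /eqP <-] := phiP _ (froot_f y); rewrite ephi.
have rmem z : froot f z \in roots f (order f (froot f z)).
  by rewrite rootsP froot_f eqxx.
have rxy : froot f x = froot f y.
  move/eqP: ephi; rewrite /phi eo nth_uniq.
  - move=> /eqP e; rewrite -(nth_index x (rmem x)) eo e.
    by rewrite (set_nth_default y) ?nth_index // ?index_mem.
  - by rewrite -szE -eo index_mem rmem.
  - by rewrite -szE index_mem rmem.
  - by rewrite filter_uniq // enum_uniq.
have /andP [_ /eqP o] := phiP _ (froot_f y).
rewrite -(iter_findex (con x)) -[RHS](iter_findex (con y)).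
have fi z : findex g (phi (froot f z)) (h z) = findex f (froot f z) z.
  have /andP [_ /eqP oz] := phiP _ (froot_f z).
  by rewrite /h findex_iter // oz findex_max.
by rewrite -!fi rxy exy.
Qed.

End Conjugacy.

(** The injections in both directions make T and U equinumerous, so that the
    first of them is bijective. *)
Lemma norder_conj_exists (T U : finType) (f : T -> T) (g : U -> U) :
  injective f -> injective g -> (forall l, norder f l = norder g l) ->
  exists2 h : T -> U, bijective h & forall x, h (f x) = g (h x).
Proof.
move=> injf injg eqN; have [h injh hf] := conj_exists injf injg eqN.
have [h' injh' _] := conj_exists injg injf (fun l => esym (eqN l)).
by exists h => //; apply: inj_card_bij injh (leq_card h' injh').
Qed.

Definition perm_digraph (G : digraph) (f : G -> G) : Prop :=
  injective f /\ forall x y, darc x y = (f x == y).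

(** Isomorphisms between graphs of permutations are conjugations. *)
Lemma diso_norder (G H : digraph) (f : G -> G) (g : H -> H) :
  perm_digraph f -> perm_digraph g ->
  diso G H <-> forall l, norder f l = norder g l.
Proof.
move=> [injf df] [injg dg]; split => [[h bijh dh] l | eqN].
  apply/esym/(norder_conj l injf injg bijh) => x; apply/esym/eqP.
  by rewrite -dg dh df.
have [h bijh hf] := norder_conj_exists injf injg eqN; exists h => // x y.
by rewrite dg df -hf (bij_eq bijh).
Qed.

Lemma perm_digraph_prod (G H : digraph) (f : G -> G) (g : H -> H) :
  perm_digraph f -> perm_digraph g ->
  @perm_digraph (dprod G H) (prodf f g).
Proof.
move=> [injf df] [injg dg]; split; first exact: prodf_inj.
by move=> [x y] [x' y']; rewrite /= df dg.
Qed.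

Definition of_lengths (s : seq nat) : digraph :=
  foldr (fun l H => dsum (dcycle l) H) dempty s.

Lemma order_ordS n (i : 'I_n) : order (@ordS n) i = n.
Proof.
apply: eq_dvdn => k; rewrite -iter_fix_order; last exact: ordS_inj.
have itE : iter k (@ordS n) i = (i + k) %% n :> nat.
  elim: k => [|k IH]; first by rewrite addn0 modn_small.
  by rewrite iterS /= IH addnS -addn1 modnDml addn1.
rewrite -val_eqE /= itE -[in X in _ == X](modn_small (ltn_ord i)).
by rewrite -[X in _ == X %% _]addn0 eqn_modDl mod0n.
Qed.

Definition sumf (T U : Type) (f : T -> T) (g : U -> U) (p : T + U) : T + U :=
  match p with inl x => inl (f x) | inr y => inr (g y) end.

Lemma sumf_inj (T U : Type) (f : T -> T) (g : U -> U) :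
  injective f -> injective g -> injective (sumf f g).
Proof. by move=> injf injg [x|y] [x'|y'] //= [] => [/injf-> | /injg->]. Qed.

Lemma norder_sumf (T U : finType) (f : T -> T) (g : U -> U) l :
  injective f -> injective g ->
  norder (sumf f g) l = norder f l + norder g l.
Proof.
move=> injf injg; have injs := sumf_inj injf injg.
rewrite !norder_sum big_sumType /=; congr addn; apply: eq_bigr => x _.
  by rewrite (@order_conj _ _ f (sumf f g) inl) // => a b [].
by rewrite (@order_conj _ _ g (sumf f g) inr) // => a b [].
Qed.

Lemma perm_of_lengths (s : seq nat) : all (leq 1) s ->
  exists2 f : of_lengths s -> of_lengths s,
    perm_digraph f & forall l, norder f l = l * count_mem l s.
Proof.
elim: s => [_|n s IH /= /andP [n1 /IH [f [injf df] Nf]]].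
  exists id; first by split=> // -[].
  by move=> l; rewrite muln0 /norder eq_card0 // => -[].
exists (sumf (@ordS n) f).
  split; first by apply: sumf_inj => //; exact: ordS_inj.
  move=> [x|x] [y|y] //=.
  by rewrite eq_sym.
move=> l; rewrite (@norder_sumf 'I_n (of_lengths s)) //; last exact: ordS_inj.
rewrite Nf mulnDr; congr addn; rewrite norder_sum.
under eq_bigr do rewrite order_ordS.
by rewrite sum_nat_const card_ord; case: eqP => [->|]; rewrite ?muln1 ?muln0.
Qed.

(** The points of order l are grouped in cycles of l points. *)
Lemma sum_of_cyclesP (G : digraph) : sum_of_cycles G ->
  exists2 f : G -> G, perm_digraph f & forall l, l %| norder f l.
Proof.
move=> [s s1 [h bijh dh]]; have [g [injg dg] Ng] := perm_of_lengths s1.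
have [h' hK h'K] := bijh.
have injf : injective (h' \o g \o h).
  by move=> x y /= /(can_inj h'K) /injg /(can_inj hK).
exists (h' \o g \o h).
  by split=> // x y; rewrite -dh dg /= (can2_eq h'K hK).
move=> l; rewrite -(norder_conj l injf injg bijh) ?Ng ?dvdn_mulr // => x /=.
by rewrite h'K.
Qed.

(** The orbit of x is a directed cycle with as many vertices as its order. *)
Lemma order_cycle_lengths (G : digraph) (f : G -> G) x :
  perm_digraph f -> order f x \in cycle_lengths G.
Proof.
move=> [injf df]; rewrite mem_filter mem_iota order_gt0 /=.
rewrite add1n ltnS order_le_card andbT.
have so : size (orbit f x) == order f x by rewrite size_orbit.
apply/card_gt0P; exists [set y in orbit f x]; rewrite inE.
apply/existsP; exists (Tuple so); rewrite eqxx andbT /ucycleb orbit_uniq andbT /=.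
have := cycle_orbit injf x; apply: sub_cycle => a b /=; by rewrite df.
Qed.

(** * Solutions as vectors of multiplicities *)

(** The left-hand side of the equation at k. The vertices of A are numbered,
    o a is the order of vertex number a, and d i is the number of cycles of
    length i.+1 in X, so that X has i.+1 * d i vertices of that order. *)
Definition conv n q (o : nat -> nat) (d : 'I_q -> nat) k :=
  \sum_(a < n) \sum_(i < q) (lcmn (o a) i.+1 == k) * (i.+1 * d i).

(** X has q vertices, whence the bound on the multiplicities. The equation at
    k = 0 is vacuous: an lcm of orders is positive. *)
Definition solutions n m q (o b : nat -> nat) : {set {ffun 'I_q -> 'I_q.+1}} :=
  [set d : {ffun 'I_q -> 'I_q.+1} | [forall i : 'I_q, d i <= q %/ i.+1] &&
           [forall k : 'I_m.+1, conv n o (fun i => d i) k == b k]].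

Section Lengths.
Variables (q : nat) (d : 'I_q -> nat).

Definition lengths : seq nat := flatten [seq nseq (d i) i.+1 | i : 'I_q].

Lemma lengths_gt0 : all (leq 1) lengths.
Proof.
apply/allP => l /flattenP [s /mapP [i _ ->]].
by rewrite mem_nseq => /andP [_ /eqP->].
Qed.

Lemma count_lengths l : count_mem l lengths = \sum_(i < q) (i.+1 == l) * d i.
Proof.
rewrite /lengths count_flatten -map_comp sumnE big_map big_enum /=.
by apply: eq_bigr => i _; rewrite count_nseq.
Qed.

Lemma count_lengths_ord (i : 'I_q) : count_mem i.+1 lengths = d i.
Proof.
rewrite count_lengths (bigD1 i) //= eqxx mul1n big1 ?addn0 // => j.
by rewrite eqSS val_eqE => /negPf ->.
Qed.

Lemma count_lengths_gt0 l : 0 < count_mem l lengths -> l <= q.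
Proof.
rewrite count_lengths lt0n sum_nat_eq0 => /forallPn [i /=].
by rewrite muln_eq0 eqb0 negb_or negbK => /andP [/eqP <-].
Qed.

End Lengths.

Lemma leq_lcmn_mul a b : 0 < a -> 0 < b -> lcmn a b <= a * b.
Proof.
by move=> a0 b0; rewrite dvdn_leq ?muln_gt0 ?a0 // dvdn_lcm dvdn_mulr ?dvdn_mull.
Qed.

Section Solutions.
Variables (A B : digraph) (f : A -> A) (g : B -> B).
Hypotheses (pf : perm_digraph f) (pg : perm_digraph g).
Variables (e : A -> 'I_(dsize A)) (o b : nat -> nat).
Hypotheses (bije : bijective e) (oE : forall x, o (e x) = order f x).
Hypothesis bE : forall k, b k = norder g k.
Let n := dsize A.
Let m := dsize B.
Let q := m %/ n.

Lemma norder_conv (U : finType) (h : U -> U) k :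
  injective h -> (forall l, l %| norder h l) -> (forall y, order h y <= q) ->
  norder (prodf f h) k = conv n o (fun i : 'I_q => norder h i.+1 %/ i.+1) k.
Proof.
move=> injh hd le_q; have [injf _] := pf.
rewrite (norder_prod _ injf injh le_q) /conv.
rewrite [RHS](reindex e) /=; last exact: onW_bij.
apply: eq_bigr => x _; apply: eq_bigr => i _.
by rewrite oE [in RHS](mulnC i.+1) divnK.
Qed.

(** This is why the equations at lengths at most m suffice: the lcm of an order
    in A and of a length at most q is at most n * q. *)
Lemma conv_large (d : 'I_q -> nat) k : m < k -> conv n o d k = 0.
Proof.
move=> lt_mk; rewrite /conv big1 // => a _; rewrite big1 // => i _.
case: eqP => //= ek; suff: k <= m by rewrite leqNgt lt_mk.
have [e' _ e'K] := bije.
have oa : o a = order f (e' a) by rewrite -oE e'K.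
have oan : o a <= n by rewrite oa; exact: order_le_card.
rewrite -ek; apply: leq_trans (leq_lcmn_mul _ _) _ => //.
  by rewrite oa order_gt0.
apply: leq_trans (leq_mul oan (ltn_ord i)) _.
by rewrite mulnC leq_trunc_div.
Qed.

Lemma solution_norder (X : digraph) (h : X -> X) :
  sum_of_cycles X -> perm_digraph h -> (forall l, l %| norder h l) ->
  (forall y, order h y <= q) ->
  solution A B X <->
    forall k : 'I_m.+1, conv n o (fun i : 'I_q => norder h i.+1 %/ i.+1) k = b k.
Proof.
move=> sX ph hd le_q.
have [injh _] := ph; have NE k := norder_conv k injh hd le_q.
rewrite /solution (diso_norder (perm_digraph_prod pf ph) pg).
split=> [[_ eN] k|eN]; first by rewrite -NE eN bE.
split=> // k; rewrite NE; have [le_km|lt_mk] := leqP k m.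
  by rewrite -bE -(eN (Ordinal (le_km : k < m.+1))).
rewrite conv_large //; apply/esym/eqP; rewrite norder_sum sum_nat_eq0.
apply/forallP => y; rewrite /= eqb0; apply: contraTneq lt_mk => <-.
by rewrite -leqNgt; exact: order_le_card.
Qed.

Lemma solution_dsize (X : digraph) : solution A B X -> n * dsize X = m.
Proof.
move=> [_ [h bijh _]].
by have := bij_eq_card bijh; rewrite card_prod.
Qed.

Lemma no_solution : 0 < m < n -> number_of_solutions A B 0.
Proof.
move=> /andP [m0 mn]; exists (fun i => A); split=> [[]//|[]//|Y].
move/solution_dsize; case: (dsize Y) => [|y]; first by lia.
by rewrite mulnS; lia.
Qed.

Hypothesis n_gt0 : 0 < n.

(** Each vector gives a sum of cycles, and distinct vectors give non isomorphic
    ones. Conversely a solution X satisfies |A| |X| = |B|, so that X has q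
    vertices, which bounds the lengths and the multiplicities. *)
Lemma number_of_solutionsE : number_of_solutions A B #|solutions n m q o b|.
Proof.
pose ds (i : 'I_#|solutions n m q o b|) : 'I_q -> nat := fun j => enum_val i j.
have dsP i : [forall j : 'I_q, ds i j <= q %/ j.+1] &&
             [forall k : 'I_m.+1, conv n o (ds i) k == b k].
  by have := enum_valP i; rewrite inE.
have X_ i := perm_of_lengths (lengths_gt0 (ds i)).
have soc i : sum_of_cycles (of_lengths (lengths (ds i))).
  exists (lengths (ds i)); first exact: lengths_gt0.
  by exists id; first exact: inv_bij.
exists (fun i => of_lengths (lengths (ds i))); split.
- move=> i; have [h ph Nh] := X_ i.
  apply/(solution_norder (soc i) ph) => [l||].
  + by rewrite Nh dvdn_mulr.
  + move=> y; apply: (@count_lengths_gt0 _ (ds i)).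
    suff: 0 < norder h (order h y) by rewrite Nh muln_gt0 => /andP [].
    by apply/card_gt0P; exists y; rewrite inE.
  + move=> k; have /andP [_ /forallP /(_ k) /eqP <-] := dsP i.
    apply: eq_bigr => a _; apply: eq_bigr => j _.
    by rewrite Nh count_lengths_ord mulKn.
- move=> i j; have [h ph Nh] := X_ i; have [h' ph' Nh'] := X_ j.
  rewrite (diso_norder ph ph') => eN; apply: enum_val_inj; apply/ffunP => k.
  apply: val_inj; apply/eqP; rewrite -(eqn_pmul2l (ltn0Sn k)).
  have := eN k.+1; rewrite Nh Nh' !count_lengths_ord => /eqP.
  exact.
move=> Y solY; have [soY _] := solY; have [h ph hd] := sum_of_cyclesP soY.
have eq_q : dsize Y = q by rewrite /q -(solution_dsize solY) mulKn.
have le_q y : order h y <= q by rewrite -eq_q; exact: order_le_card.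
have leN l : norder h l <= q by rewrite -eq_q; exact: max_card.
pose d := [ffun i : 'I_q => inord (norder h i.+1 %/ i.+1) : 'I_q.+1].
have dE i : d i = norder h i.+1 %/ i.+1 :> nat.
  by rewrite ffunE inordK // ltnS (leq_trans (leq_div _ _)).
have dS : d \in solutions n m q o b.
  rewrite inE; apply/andP; split; apply/forallP => k.
    by rewrite dE leq_div2r.
  apply/eqP; move/(solution_norder soY ph hd le_q): solY => <-.
  by apply: eq_bigr => a _; apply: eq_bigr => j _; rewrite dE.
exists (enum_rank_in dS d); have [h' ph' Nh'] := X_ (enum_rank_in dS d).
apply/(diso_norder ph ph') => l; rewrite Nh'.
have [|lt_ql] := boolP (0 < l <= q).
  case: l => // l lt_l; rewrite (count_lengths_ord _ (Ordinal (lt_l : l < q))).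
  by rewrite /ds enum_rankK_in // dE mulnC divnK.
have -> : norder h l = 0.
  apply/eqP; rewrite norder_sum sum_nat_eq0; apply/forallP => y /=.
  by rewrite eqb0; apply: contraNneq lt_ql => <-; rewrite order_gt0 le_q.
case: l lt_ql => // l lt_ql; apply/esym/eqP; rewrite muln_eq0 /= eqn0Ngt.
by apply: contra lt_ql => /count_lengths_gt0.
Qed.

End Solutions.

(** * A language of bounded loops and its compiler *)

(** Variables and arrays are fixed enumerations, so that whether a given program
    modifies one of them is decided by computation. *)
Inductive var : Type :=
  Vn | Vm | Vres | Vq | Va | Vp | Vl | Vx | Vi | Vw | Vu | Vv | Vold | Vnew |
  Vc | VP | Vs | Vt | Vk | Vok | Vcarry.

Inductive arr : Type := Aord | Anum | Alab | Ay | Aacc.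

Definition vidx (v : var) : nat :=
  match v with
  | Vn => 0 | Vm => 1 | Vres => 2 | Vq => 3 | Va => 4 | Vp => 5 | Vl => 6
  | Vx => 7 | Vi => 8 | Vw => 9 | Vu => 10 | Vv => 11 | Vold => 12 | Vnew => 13
  | Vc => 14 | VP => 15 | Vs => 16 | Vt => 17 | Vk => 18 | Vok => 19
  | Vcarry => 20
  end.

Definition aidx (a : arr) : nat :=
  match a with Aord => 1 | Anum => 2 | Alab => 3 | Ay => 4 | Aacc => 5 end.

Definition veq (v w : var) := eqn (vidx v) (vidx w).
Definition aeq (a b : arr) := eqn (aidx a) (aidx b).

Lemma veqP v w : reflect (v = w) (veq v w).
Proof. by apply: (iffP idP) => [|->]; case: v; case: w. Qed.

Lemma aeqP a b : reflect (a = b) (aeq a b).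
Proof. by apply: (iffP idP) => [|->]; case: a; case: b. Qed.

Inductive expr : Type :=
| Var of var
| Cst of nat
| Plus of expr & expr
| Minus of expr & expr
| Inp of expr
| Get of arr & expr.

Inductive cmd : Type :=
| Skip
| Assign of var & expr
| Put of arr & expr & expr
| Seq of cmd & cmd
| If of expr & cmd & cmd
| For of var & expr & cmd.

Record store : Type := Store { vars : var -> nat; arrs : arr -> nat -> nat }.

Definition setv (s : store) v k : store :=
  Store (fun w => if veq w v then k else vars s w) (arrs s).
Definition seta (s : store) a i k : store :=
  Store (vars s) (fun b =>
    if aeq b a then fun j => if j == i then k else arrs s b j else arrs s b).

Section Semantics.
Variable inp : nat -> nat.

Fixpoint ev (s : store) (e : expr) : nat :=
  match e with
  | Var v => vars s v
  | Cst k => k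
  | Plus e1 e2 => ev s e1 + ev s e2
  | Minus e1 e2 => ev s e1 - ev s e2
  | Inp e1 => inp (ev s e1)
  | Get a e1 => arrs s a (ev s e1)
  end.

(** The counter of a loop is an ordinary variable, incremented after each round;
    the number of rounds is fixed when the loop is entered. *)
Definition loop v (body : store -> store) (s : store) : store :=
  let s' := body s in setv s' v (vars s' v).+1.

Fixpoint den (c : cmd) (s : store) : store :=
  match c with
  | Skip => s
  | Assign v e => setv s v (ev s e)
  | Put a e1 e2 => seta s a (ev s e1) (ev s e2)
  | Seq c1 c2 => den c2 (den c1 s)
  | If e c1 c2 => if ev s e == 0 then den c2 s else den c1 s
  | For v e c1 => iter (ev s e) (loop v (den c1)) (setv s v 0)
  end.

(** The costs count the instructions of the compiled code. *)
Fixpoint ecost (e : expr) : nat :=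
  match e with
  | Var _ | Cst _ => 1
  | Plus e1 e2 | Minus e1 e2 => ecost e1 + ecost e2 + 1
  | Inp e1 => ecost e1 + 3
  | Get _ e1 => ecost e1 + 7
  end.

Fixpoint cost (c : cmd) (s : store) : nat :=
  match c with
  | Skip => 0
  | Assign v e => ecost e + 1
  | Put a e1 e2 => ecost e1 + ecost e2 + 7
  | Seq c1 c2 => cost c1 s + cost c2 (den c1 s)
  | If e c1 c2 =>
      ecost e + 1 + (if ev s e == 0 then cost c2 s else (cost c1 s).+1)
  | For v e c1 =>
      ecost e + 2 +
      \sum_(i < ev s e) (cost c1 (iter i (loop v (den c1)) (setv s v 0)) + 5)
  end.

End Semantics.

(** Register 0 is scratch, 1 holds the number of input cells, 2 holds 0, and the
    others alternate between the variables and the temporaries. *)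
Definition regv (v : var) := 3 + (vidx v).*2.
Definition regt (d : nat) := 4 + d.*2.

(** The arrays are interleaved above the base input cells: cell j of array a is
    at address base + 8 j + aidx a. As aidx a lies between 1 and 7, distinct
    cells have distinct addresses, and the cell at address base remains 0. *)
Definition addr d a : program :=
  [:: IAdd (regt d) (regt d) (regt d); IAdd (regt d) (regt d) (regt d);
      IAdd (regt d) (regt d) (regt d); IAdd (regt d) (regt d) 1;
      IConst 0 (aidx a); IAdd (regt d) (regt d) 0].

Lemma size_addr d a : size (addr d a) = 6. Proof. by []. Qed.
Opaque addr.

(** The value is left in temporary d. Two truncated subtractions from base clamp
    the index of an input cell to base, where 0 is read, the default value of
    the input. *)
Fixpoint code_expr d (e : expr) : program :=
  match e with
  | Var v => [:: IAdd (regt d) (regv v) 2]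
  | Cst k => [:: IConst (regt d) k]
  | Plus e1 e2 =>
      code_expr d e1 ++ code_expr d.+1 e2 ++ [:: IAdd (regt d) (regt d) (regt d.+1)]
  | Minus e1 e2 =>
      code_expr d e1 ++ code_expr d.+1 e2 ++ [:: ISub (regt d) (regt d) (regt d.+1)]
  | Inp e1 =>
      code_expr d e1 ++ [:: ISub (regt d) 1 (regt d); ISub (regt d) 1 (regt d);
                        IRead (regt d) (regt d)]
  | Get a e1 => code_expr d e1 ++ addr d a ++ [:: IRead (regt d) (regt d)]
  end.

(** The code is placed at address k, and jumps are absolute; a jump that tests
    register 2 is always taken. Temporary d counts the remaining rounds of a
    loop, whose body uses the temporaries above d. *)
Fixpoint code_cmd k d (c : cmd) : program :=
  match c with
  | Skip => [::]
  | Assign v e => code_expr d e ++ [:: IAdd (regv v) (regt d) 2]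
  | Put a e1 e2 =>
      code_expr d e1 ++ addr d a ++ code_expr d.+1 e2 ++
      [:: IWrite (regt d) (regt d.+1)]
  | Seq c1 c2 => let p1 := code_cmd k d c1 in p1 ++ code_cmd (k + size p1) d c2
  | If e c1 c2 =>
      let pe := code_expr d e in
      let k1 := k + size pe + 1 in
      let p1 := code_cmd k1 d c1 in
      let k2 := k1 + size p1 + 1 in
      let p2 := code_cmd k2 d c2 in
      pe ++ [:: IJz (regt d) k2] ++ p1 ++ [:: IJz 2 (k2 + size p2)] ++ p2
  | For v e c1 =>
      let pe := code_expr d e in
      let k0 := k + size pe + 1 in
      let p1 := code_cmd (k0 + 1) d.+1 c1 in
      pe ++ [:: IAdd (regv v) 2 2; IJz (regt d) (k0 + size p1 + 5)] ++ p1 ++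
      [:: IConst 0 1; IAdd (regv v) (regv v) 0; ISub (regt d) (regt d) 0;
          IJz 2 k0]
  end.

Lemma size_code_expr d e : size (code_expr d e) = ecost e.
Proof.
elim: e d => //= [e1 IH1 e2 IH2|e1 IH1 e2 IH2|e1 IH1|a e1 IH1] d;
  by rewrite !size_cat ?size_addr /= ?IH1 ?IH2 ?addnA.
Qed.

Section Compiler.
Variable p : program.

Definition code_at k (c : program) :=
  forall i, i < size c -> onth p (k + i) = onth c i.

Lemma code_at_cat k c1 c2 :
  code_at k (c1 ++ c2) -> code_at k c1 /\ code_at (k + size c1) c2.
Proof.
move=> H; split=> i lt_i.
  by rewrite H ?size_cat ?ltn_addr // !onthE map_cat nth_cat size_map lt_i.
rewrite -addnA H ?size_cat ?ltn_add2l // !onthE map_cat nth_cat size_map.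
by rewrite ltnNge leq_addr addKn.
Qed.

Definition steps t (q q' : state) := iter t (obind (step p)) (Some q) = Some q'.

Lemma steps_trans t1 t2 q1 q2 q3 :
  steps t1 q1 q2 -> steps t2 q2 q3 -> steps (t1 + t2) q1 q3.
Proof. by rewrite /steps addnC iterD => ->. Qed.

Lemma steps1 (q : state) i : onth p (pc q) = Some i -> steps 1 q (exec i q).
Proof. by rewrite /steps /= /step => ->. Qed.

Lemma code_at1 k i c : code_at k (i :: c) -> onth p k = Some i.
Proof. by move=> /(_ 0 isT); rewrite addn0. Qed.

Lemma code_atS k i c : code_at k (i :: c) -> code_at k.+1 c.
Proof. by move=> H j lt_j; rewrite addSnnS H. Qed.

Definition exec_all (c : program) q := foldl (fun q i => exec i q) q c.

Definition jump_free (i : instr) := if i is IJz _ _ then false else true.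

Lemma exec_pc i q : jump_free i -> pc (exec i q) = (pc q).+1.
Proof. by case: i => //=; case: q. Qed.

Lemma steps_straight c k q : code_at k c -> all jump_free c -> pc q = k ->
  steps (size c) q (exec_all c q) /\ pc (exec_all c q) = k + size c.
Proof.
elim: c k q => [|i c IH] k q H /=; first by rewrite addn0.
move=> /andP [ji jc] eq_k.
have [] := IH k.+1 (exec i q) (code_atS H) jc; first by rewrite exec_pc ?eq_k.
move=> st ->; rewrite addSnnS; split=> //; rewrite -add1n.
by apply: steps_trans st; apply: steps1; rewrite eq_k (code_at1 H).
Qed.

Variables (inp : nat -> nat) (base : nat).

Record sim (s : store) (q : state) : Prop := Sim {
  sim1 : regs q 1 = base;
  sim2 : regs q 2 = 0;
  simv : forall v, regs q (regv v) = vars s v;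
  simi : forall x, x <= base -> cells q x = inp x;
  sima : forall a x, cells q (base + 8 * x + aidx a) = arrs s a x }.

Hypothesis inp_end : forall x, base <= x -> inp x = 0.

Lemma regt_inj : injective regt.
Proof. by move=> x y; rewrite /regt; lia. Qed.

Lemma regtv d v : (regt d == regv v) = false.
Proof. by rewrite /regt /regv; apply/negP => /eqP; lia. Qed.

Lemma regvt d v : (regv v == regt d) = false.
Proof. by rewrite eq_sym regtv. Qed.

Lemma regvv v w : (regv v == regv w) = veq v w.
Proof.
apply/eqP/veqP => [|-> //]; rewrite /regv => e; apply/veqP.
by apply/eqnP; lia.
Qed.

(** Expressions may overwrite register 0 and the temporaries from d on. *)
Definition yields d (x : nat) (q q' : state) : Prop :=
  [/\ regs q' (regt d) = x, cells q' =1 cells q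
    & forall r, r != 0 -> (forall j, d <= j -> r != regt j) ->
        regs q' r = regs q r].

Lemma exec_all_cat c1 c2 q : exec_all (c1 ++ c2) q = exec_all c2 (exec_all c1 q).
Proof. exact: foldl_cat. Qed.

Lemma regt_neq i j : (regt i == regt j) = (i == j).
Proof. by rewrite (inj_eq regt_inj). Qed.

Lemma sim_yields s q q' d x : sim s q -> yields d x q q' -> sim s q'.
Proof.
move=> [h1 h2 hv hi ha] [_ hc hr]; split.
- by rewrite hr.
- by rewrite hr.
- by move=> v; rewrite hr // => j _; rewrite regvt.
- by move=> y le_y; rewrite hc hi.
- by move=> a y; rewrite hc ha.
Qed.

Lemma addrP d a x q : regs q (regt d) = x -> regs q 1 = base ->
  yields d (base + 8 * x + aidx a) q (exec_all (addr d a) q).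
Proof.
Transparent addr.
case: q => n R M /= ex e1; split=> [|//|r r0 hr]; rewrite /addr.
- by rewrite /= !eqxx ex e1 /=; lia.
by rewrite /= (negPf r0) (negPf (hr d (leqnn d))).
Qed.

Lemma jump_free_addr d a : all jump_free (addr d a).
Proof. by []. Qed.
Opaque addr.

Lemma jump_free_code_expr d e : all jump_free (code_expr d e).
Proof.
elim: e d => //= [e1 IH1 e2 IH2|e1 IH1 e2 IH2|e1 IH1|a e1 IH1] d;
  by rewrite !all_cat ?jump_free_addr /= ?IH1 ?IH2.
Qed.

Lemma yields_trans d x y q1 q2 q3 :
  yields d x q1 q2 -> yields d y q2 q3 -> yields d y q1 q3.
Proof.
move=> [_ hc hr] [h3 hc3 hr3]; split=> // [z|r r0 rj]; first by rewrite hc3.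
by rewrite hr3 // hr.
Qed.

Lemma yieldsS d x y z q1 q2 q3 q4 :
  yields d x q1 q2 -> yields d.+1 y q2 q3 ->
  (regs q3 (regt d) = x -> regs q3 (regt d.+1) = y -> yields d z q3 q4) ->
  yields d z q1 q4.
Proof.
move=> [hx hc hr] [hy hc3 hr3] h4.
have ex : regs q3 (regt d) = x.
  by rewrite hr3 // => j lt_dj; rewrite regt_neq ltn_eqF.
have [hz hc4 hr4] := h4 ex hy; split=> // [w|r r0 rj].
  by rewrite hc4 hc3 hc.
rewrite hr4 // hr3 ?hr // => j lt_dj; exact: rj (ltnW lt_dj).
Qed.

Lemma code_exprP d e s q : sim s q -> yields d (ev inp s e) q (exec_all (code_expr d e) q).
Proof.
elim: e d q => [v|k|e1 IH1 e2 IH2|e1 IH1 e2 IH2|e1 IH1|a e1 IH1] d q S /=.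
- case: q S => n R M [_ /= h2 hv _ _]; split=> [|//|r r0 rj] /=.
    by rewrite eqxx hv h2 addn0.
  by rewrite (negPf (rj d (leqnn d))).
- case: q S => n R M _; split=> [|//|r r0 rj] /=; first by rewrite eqxx.
  by rewrite (negPf (rj d (leqnn d))).
- have Y1 := IH1 d q S; have S1 := sim_yields S Y1; have Y2 := IH2 d.+1 _ S1.
  rewrite !exec_all_cat; apply: yieldsS Y1 Y2 _; case: (exec_all _ _) => n R M /= -> ->.
  split=> [|//|r r0 rj] /=; first by rewrite eqxx.
  by rewrite (negPf (rj d (leqnn d))).
- have Y1 := IH1 d q S; have S1 := sim_yields S Y1; have Y2 := IH2 d.+1 _ S1.
  rewrite !exec_all_cat; apply: yieldsS Y1 Y2 _; case: (exec_all _ _) => n R M /= ex ey.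
  split=> [|//|r r0 rj] /=; first by rewrite eqxx ex ey.
  by rewrite (negPf (rj d (leqnn d))).
- have Y1 := IH1 d q S; have S1 := sim_yields S Y1; have [h _ _] := Y1.
  rewrite exec_all_cat; apply: yields_trans Y1 _.
  move: S1 h; case: (exec_all _ _) => n R M [/= h1 _ _ hi _] ex.
  split=> [|//|r r0 rj] /=; last by rewrite (negPf (rj d (leqnn d))).
  rewrite !eqxx h1 ex; set x := ev _ _ _; have [le_x|lt_x] := leqP x base.
    by rewrite hi ?leq_subr // subKn.
  by rewrite hi ?leq_subr // !inp_end //; lia.
- have Y1 := IH1 d q S; have S1 := sim_yields S Y1; have [h _ _] := Y1.
  rewrite !exec_all_cat; apply: yields_trans Y1 _.
  have YA := addrP a h (sim1 S1); have SA := sim_yields S1 YA.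
  apply: (yields_trans YA); have [+ _ _] := YA.
  move: SA; case: (exec_all (addr _ _) _) => n R M [/= _ _ _ _ ha] ex.
  split=> [|//|r r0 rj] /=; last by rewrite (negPf (rj d (leqnn d))).
  by rewrite !eqxx ex ha.
Qed.

Definition keeps d (q q' : state) :=
  forall j, j < d -> regs q' (regt j) = regs q (regt j).

Lemma yields_keeps d x q q' : yields d x q q' -> keeps d q q'.
Proof.
move=> [_ _ hr] j lt_j; rewrite hr // => i le_i.
by rewrite regt_neq; lia.
Qed.

Lemma steps_code_expr k d e s q : code_at k (code_expr d e) -> pc q = k -> sim s q ->
  exists q', [/\ steps (ecost e) q q', pc q' = k + ecost e, sim s q',
                 regs q' (regt d) = ev inp s e & keeps d q q'].
Proof.
move=> H eq_k S; have Y := code_exprP d e S.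
have [st epc] := steps_straight H (jump_free_code_expr d e) eq_k.
exists (exec_all (code_expr d e) q); rewrite -(size_code_expr d); split=> //.
- exact: sim_yields S Y.
- by have [] := Y.
- exact: yields_keeps Y.
Qed.

Lemma sim_setv s n R M v x : sim s (State n R M) ->
  forall n', sim (setv s v x) (State n' [eta R with regv v |-> x] M).
Proof.
move=> [/= h1 h2 hv hi ha] n'; split=> //= w.
by rewrite regvv hv.
Qed.

Lemma sim_pc s n n' R M : sim s (State n R M) -> sim s (State n' R M).
Proof. by case. Qed.

Lemma keeps_trans d q1 q2 q3 : keeps d q1 q2 -> keeps d q2 q3 -> keeps d q1 q3.
Proof. by move=> h12 h23 j lt_j; rewrite h23 ?h12. Qed.

Lemma keepsW d q q' : keeps d.+1 q q' -> keeps d q q'.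
Proof. by move=> h j lt_j; rewrite h // ltnW. Qed.

Definition runs t k d s' q :=
  exists q', [/\ steps t q q', pc q' = k, sim s' q' & keeps d q q'].

Lemma runs_trans t1 t2 k d s q q1 : steps t1 q q1 -> keeps d q q1 ->
  runs t2 k d s q1 -> runs (t1 + t2) k d s q.
Proof.
move=> st K [q2 [st2 e2 S2 K2]]; exists q2; split=> //.
  exact: steps_trans st st2.
exact: keeps_trans K K2.
Qed.

(** In the case of a loop, the induction is on the number of remaining rounds,
    which temporary d holds. *)
Lemma code_cmdP c k d s q : code_at k (code_cmd k d c) -> pc q = k -> sim s q ->
  runs (cost inp c s) (k + size (code_cmd k d c)) d (den inp c s) q.
Proof.
elim: c k d s q => [|v e|a e1 e2|c1 IH1 c2 IH2|e c1 IH1 c2 IH2|v e c1 IH1] k d s q /=.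
- by move=> _ eq_k S; exists q; rewrite addn0.
- move=> /code_at_cat [He /code_at1 Hi] eq_k S.
  have [q1 [st e1 S1 r1 K1]] := steps_code_expr He eq_k S.
  rewrite size_code_expr -e1 in Hi; apply: runs_trans st K1 _.
  exists (exec (IAdd (regv v) (regt d) 2) q1); split.
  + exact: steps1.
  + by rewrite exec_pc // e1 size_cat size_code_expr /= addnA addn1.
  + case: q1 S1 r1 {e1 Hi} => n R M S1 /= ->.
    by have /= -> := sim2 S1; rewrite addn0; exact: sim_setv S1 _.
  + by case: q1 {S1 r1 e1 Hi} => n R M j /= lt_j; rewrite regtv.
- move=> /code_at_cat [H1 /code_at_cat [Ha /code_at_cat [H2 /code_at1 Hi]]] eq_k S.
  have [q1 [st1 p1 S1 r1 K1]] := steps_code_expr H1 eq_k S.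
  rewrite !size_code_expr /= in Ha H2 Hi.
  have YA := addrP a r1 (sim1 S1); have SA := sim_yields S1 YA.
  have [//|stA pA] := steps_straight Ha _ p1; rewrite size_addr in stA pA.
  have [q2 [st2 p2 S2 r2 K2]] := steps_code_expr H2 pA SA.
  rewrite (_ : _ + 7 = ecost e1 + (6 + (ecost e2 + 1))); last by lia.
  apply: runs_trans st1 K1 _; apply: runs_trans stA (yields_keeps YA) _.
  apply: runs_trans st2 (keepsW K2) _; rewrite -p2 in Hi.
  exists (exec (IWrite (regt d) (regt d.+1)) q2); split.
  + exact: steps1.
  + by rewrite exec_pc // p2 !size_cat !size_code_expr /=; lia.
  + have {YA}[rA _ _] := YA.
    have rA2 := K2 d (ltnSn d); rewrite rA in rA2.
    move: S2 r2 rA2; case: q2 {Hi p2 K2} => n R M [/= h1 h2 hv hi ha] e2E dE.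
    split=> //= [x le_x|b x]; rewrite dE.
      rewrite hi //; case: eqP => // ex; move: le_x; rewrite ex.
      by case: (a) => /=; lia.
    rewrite ha e2E /seta /=; case: aeqP => [->|ne].
      case: eqP => [e3|ne]; first by case: eqP => //; lia.
      by case: eqP => // ?; subst x.
    by case: eqP => //; case: (b) ne; case: (a) => //= _; lia.
  + by case: q2 {Hi p2 K2 S2 r2} => n R M j lt_j.
- move=> /code_at_cat [H1 H2] eq_k S.
  have [q1 [st1 p1 S1 K1]] := IH1 _ _ _ _ H1 eq_k S.
  apply: runs_trans st1 K1 _; rewrite size_cat addnA.
  exact: IH2 H2 p1 S1.
- move=> /code_at_cat [He H] eq_k S; have Hj := code_at1 H.
  move: H => /code_atS; rewrite -addn1 size_code_expr => /code_at_cat [H1 H].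
  have Hj2 := code_at1 H; move: H => /code_atS; rewrite -addn1 => H2.
  have [q1 [st1 p1 S1 r1 K1]] := steps_code_expr He eq_k S.
  rewrite -addnA; apply: runs_trans st1 K1 _.
  rewrite size_code_expr in Hj; rewrite size_cat /= size_cat /= size_code_expr.
  set k1 := k + ecost e + 1 in Hj H1 Hj2 H2 *.
  set m1 := size _ in Hj H1 Hj2 H2 *; set k2 := k1 + m1 + 1 in Hj Hj2 H2 *.
  set m2 := size _ in Hj2 *; rewrite -p1 in Hj.
  apply: (runs_trans (steps1 Hj)); first by case: (q1).
  have ek1 : (pc q1).+1 = k1 by rewrite p1 /k1 addn1.
  case: q1 S1 r1 {Hj p1} ek1 => n R M S1 /= -> ->.
  rewrite (_ : k + _ = k2 + m2); last by rewrite /k2 /k1; lia.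
  have [ev0|ev1] := eqVneq (ev inp s e) 0.
  + by apply: (IH2 k2) => //; exact: sim_pc S1.
  + rewrite -addn1; have [|||q2 [st2 p2 S2 K2]] := IH1 k1 d s (State k1 R M) => //.
      exact: sim_pc S1.
    apply: runs_trans st2 K2 _; rewrite -p2 in Hj2.
    exists (exec (IJz 2 (k2 + m2)) q2); split.
    * exact: steps1.
    * by case: q2 S2 {p2 Hj2} => ? ? ? S2 /=; have /= -> := sim2 S2.
    * by case: q2 S2 {p2 Hj2} => ? ? ? S2; exact: sim_pc S2.
    * by case: q2 {p2 Hj2 S2}.
- move=> /code_at_cat [He H] eq_k S; have Hv := code_at1 H.
  have Hz := code_at1 (code_atS H); move: H => /code_atS /code_atS.
  move=> /code_at_cat [H1 H]; have Hi1 := code_at1 H.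
  have Hi2 := code_at1 (code_atS H).
  have Hi3 := code_at1 (code_atS (code_atS H)).
  have Hi4 := code_at1 (code_atS (code_atS (code_atS H))).
  rewrite size_code_expr in H1 Hv Hz Hi1 Hi2 Hi3 Hi4;
      rewrite size_cat /= size_cat /= size_code_expr.
  have ek0 : (k + ecost e).+1 = k + ecost e + 1 by rewrite addn1.
  rewrite ek0 -addn1 in H1 Hz Hi1 Hi2 Hi3 Hi4.
  set k0 := k + ecost e + 1 in H1 Hz Hi1 Hi2 Hi3 Hi4 ek0 *.
  set m1 := size _ in H1 Hz Hi1 Hi2 Hi3 Hi4 *.
  set kE := k0 + m1 + 5 in Hz *.
  have [q1 [st1 p1 S1 r1 K1]] := steps_code_expr He eq_k S.
  rewrite -addnA; apply: runs_trans st1 K1 _; rewrite -p1 in Hv.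
  rewrite (_ : 2 + _ = 1 + (\sum_(0 <= i < ev inp s e)
     (cost inp c1 (iter i (loop v (den inp c1)) (setv s v 0)) + 5) + 1)); last first.
    by rewrite big_mkord addn1 -addSnnS.
  apply: (runs_trans (steps1 Hv)); first by case: (q1) => n R M j lt_j /=; rewrite regtv.
  rewrite (_ : k + _ = kE); last by rewrite /kE /k0; lia.
  set it := fun i => iter i (loop v (den inp c1)) (setv s v 0).
  set N := ev inp s e; rewrite -/(it N).
  have S2 : sim (it 0) (exec (IAdd (regv v) 2 2) q1).
    case: q1 S1 {p1 r1 Hv} => n R M S1 /=; have /= -> := sim2 S1.
    exact: sim_setv S1 _.
  have r2 : regs (exec (IAdd (regv v) 2 2) q1) (regt d) = N.
    by case: q1 r1 {S1 p1 Hv S2} => n R M /=; rewrite regtv.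
  have p2 : pc (exec (IAdd (regv v) 2 2) q1) = k0.
    by rewrite exec_pc // p1 ek0.
  move: (exec _ q1) S2 r2 p2 => q2 {q1 S1 r1 p1 Hv} S2 r2 p2.
  suff HL r i q' : i + r = N -> sim (it i) q' -> regs q' (regt d) = r ->
      pc q' = k0 -> runs (\sum_(i <= j < N) (cost inp c1 (it j) + 5) + 1)
        kE d (it N) q' by exact: (HL N 0 q2).
  elim: r i q' {q2 S2 r2 p2 S eq_k} => [|r IH] i q2 eN S2 r2 p2.
    rewrite addn0 in eN; rewrite eN big_geq // add0n.
    rewrite -p2 in Hz; exists (exec (IJz (regt d) kE) q2); split.
    + exact: steps1.
    + by case: q2 r2 {Hz S2 p2} => n R M /= ->.
    + by rewrite -eN; case: q2 S2 {Hz r2 p2} => n R M S2; exact: sim_pc S2.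
    + by case: (q2).
  rewrite big_ltn; last by rewrite -eN; lia.
  rewrite (_ : _ + 5 + _ + 1 = 1 + (cost inp c1 (it i) + (4 + (\sum_(i.+1 <= j < N)
     (cost inp c1 (it j) + 5) + 1)))); last first.
    by move: (cost _ _ _) (\sum_(_ <= _ < _) _) => x y; lia.
  have Hz' := Hz; rewrite -p2 in Hz'.
  apply: (runs_trans (steps1 Hz')); first by case: (q2).
  have S3 : sim (it i) (exec (IJz (regt d) kE) q2).
    by case: q2 S2 {Hz' r2 p2} => n R M S2; exact: sim_pc S2.
  have p3 : pc (exec (IJz (regt d) kE) q2) = k0 + 1.
    by case: q2 r2 p2 {Hz' S2 S3} => n R M /= -> ->; rewrite addn1.
  have r3 : regs (exec (IJz (regt d) kE) q2) (regt d) = r.+1.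
    by case: q2 r2 {p2 p3 Hz' S2 S3}.
  move: (exec _ q2) S3 r3 p3 => q3 {q2 S2 r2 p2 Hz'} S3 r3 p3.
  have [q4 [st4 p4 S4 K4]] := IH1 (k0 + 1) d.+1 (it i) q3 H1 p3 S3.
  apply: runs_trans st4 (keepsW K4) _.
  have r4 : regs q4 (regt d) = r.+1 by rewrite K4 // r3.
  rewrite -/m1 in p4; rewrite -p4 in Hi1 Hi2 Hi3 Hi4.
  pose tail := [:: IConst 0 1; IAdd (regv v) (regv v) 0; ISub (regt d) (regt d) 0; IJz 2 k0].
  have st5 : steps 4 q4 (exec_all tail q4).
    rewrite -[4]/(1 + (1 + (1 + 1))).
    apply: steps_trans (steps1 Hi1) _.
    apply: steps_trans (steps1 (i := IAdd (regv v) (regv v) 0) _) _; first by rewrite exec_pc.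
    apply: steps_trans (steps1 (i := ISub (regt d) (regt d) 0) _) _; first by rewrite !exec_pc.
    by apply: (steps1 (i := IJz 2 k0)); rewrite !exec_pc.
  have v0 w : (regv w == 0) = false by rewrite /regv.
  have t0 w : (regt w == 0) = false by rewrite /regt.
  apply: runs_trans st5 _ _.
    case: (q4) => n R M j lt_j /=.
    by rewrite ?t0 !regtv regt_neq ltn_eqF.
  apply: IH.
  + by rewrite -eN addSnnS.
  + rewrite /it iterS -/(it i) /loop; case: q4 S4 {Hi1 Hi2 Hi3 Hi4 p4 K4 r4} => n R M.
    case=> /= h1 h2 hv hi ha; split=> //= w; rewrite !regvt !regvv ?v0 /=.
    by rewrite ?eqxx ?v0 /= hv addn1 hv.
  + by case: q4 r4 {Hi1 Hi2 Hi3 Hi4 p4 K4 S4} => n R M /= r4;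
      rewrite ?eqxx ?regtv ?t0 ?r4 subn1.
  + case: q4 S4 {Hi1 Hi2 Hi3 Hi4 p4 K4 r4} => n R M S4 /=.
    by have /= h2 := sim2 S4; rewrite /= h2.
Qed.

End Compiler.

(** The sizes of the two tables are moved to the variables that hold them before
    register 1 receives their sum, and the result is finally moved to
    register 0. *)
Definition compile (c : cmd) : program :=
  [:: IAdd (regv Vn) 0 2; IAdd (regv Vm) 1 2; IAdd 1 0 1] ++ code_cmd 3 0 c ++
  [:: IAdd 0 (regv Vres) 2].

Definition init (n m : nat) : store :=
  Store (fun v => match v with Vn => n | Vm => m | _ => 0 end) (fun _ _ => 0).

Lemma run_compile c (u v : seq nat) :
  let inp := nth 0 (u ++ v) in let s := init (size u) (size v) in
  run (compile c) (input u v) (cost inp c s + 4) (vars (den inp c s) Vres).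
Proof.
move=> inp s; have H : code_at (compile c) 0 (compile c) by [].
have [_ H3] := code_at_cat H; have [{}H3 H4] := code_at_cat H3.
have st3 : steps (compile c) 3 (input u v)
  (exec_all [:: IAdd (regv Vn) 0 2; IAdd (regv Vm) 1 2; IAdd 1 0 1] (input u v)).
  by [].
have S : sim inp (size u + size v) s
  (exec_all [:: IAdd (regv Vn) 0 2; IAdd (regv Vm) 1 2; IAdd 1 0 1] (input u v)).
  split=> //= [[]|a x] //=; try by rewrite addn0.
  by rewrite nth_default // size_cat; case: a => /=; lia.
have inp_end x : size u + size v <= x -> inp x = 0.
  by move=> le_x; rewrite /inp nth_default // size_cat.
have [//|q [st eq_q Sq _]] := code_cmdP inp_end H3 _ S.
exists (exec (IAdd 0 (regv Vres) 2) q); split.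
- rewrite (_ : _ + 4 = 3 + (cost inp c s + 1)); last by lia.
  apply: steps_trans st3 _; apply: steps_trans st _; apply: steps1.
  by rewrite eq_q; apply: code_at1 H4.
- rewrite /step exec_pc // eq_q onthE nth_default // size_map.
  by rewrite /compile size_cat /= size_cat addn1; exact: leqnn.
- case: q Sq {st eq_q} => ? ? ? Sq /=.
  by have /= -> := simv Sq Vres; have /= -> := sim2 Sq; rewrite addn0.
Qed.

(** * Program logic *)

Fixpoint assigns (c : cmd) (v : var) : bool :=
  match c with
  | Skip | Put _ _ _ => false
  | Assign w _ => veq v w
  | Seq c1 c2 | If _ c1 c2 => assigns c1 v || assigns c2 v
  | For w _ c1 => veq v w || assigns c1 v
  end.

Fixpoint writes (c : cmd) (a : arr) : bool :=
  match c with
  | Skip | Assign _ _ => false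
  | Put b _ _ => aeq a b
  | Seq c1 c2 | If _ c1 c2 => writes c1 a || writes c2 a
  | For _ _ c1 => writes c1 a
  end.

(** What a command leaves unchanged follows from its text alone, which spares
    the specifications of the blocks from saying it. *)
Definition frame (c : cmd) (s s' : store) : Prop :=
  (forall v, ~~ assigns c v -> vars s' v = vars s v) /\
  (forall a, ~~ writes c a -> arrs s' a = arrs s a).

Lemma iter_frame (P : store -> Prop) f s k :
  (forall s', P s' -> P (f s')) -> P s -> P (iter k f s).
Proof. by move=> Pf Ps; elim: k => //= k; exact: Pf. Qed.

Section Logic.
Variable inp : nat -> nat.

Lemma den_frame c s : frame c s (den inp c s).
Proof.
elim: c s => [|v e|a e1 e2|c1 IH1 c2 IH2|e c1 IH1 c2 IH2|v e c1 IH1] s //=.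
- by split=> //= w; case: veq.
- by split=> //= b; case: aeq.
- have [v1 a1] := IH1 s; have [v2 a2] := IH2 (den inp c1 s).
  by split=> /= w; rewrite negb_or => /andP [w1 w2]; rewrite ?v2 ?v1 ?a2 ?a1.
- have [v1 a1] := IH1 s; have [v2 a2] := IH2 s.
  split=> /= w; rewrite negb_or => /andP [w1 w2]; case: eqP => _;
    by rewrite ?v2 ?v1 ?a2 ?a1.
- apply: iter_frame => [s' [v1 a1]|]; last first.
    by split=> //= w; rewrite negb_or => /andP [/negPf ->].
  have [v2 a2] := IH1 s'; split=> /= w.
    by rewrite negb_or => /andP [w1 w2]; rewrite (negPf w1) v2 // v1 //= negb_or w1.
  by move=> w1; rewrite a2 // a1.
Qed.

(** Every command terminates, so that its cost and its effect from the store s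
    are bounded and described together. *)
Definition triple (c : cmd) (s : store) (T : nat) (Q : store -> Prop) : Prop :=
  cost inp c s <= T /\ Q (den inp c s).

Lemma triple_weak c s T T' (Q Q' : store -> Prop) :
  triple c s T Q -> T <= T' -> (forall s', frame c s s' -> Q s' -> Q' s') ->
  triple c s T' Q'.
Proof.
move=> [cT qT] leT h; split; first exact: leq_trans leT.
by apply: h qT; exact: den_frame.
Qed.

Lemma triple_leq c s T T' (Q : store -> Prop) :
  triple c s T Q -> T <= T' -> triple c s T' Q.
Proof. by move=> [cT qT] leT; split=> //; exact: leq_trans leT. Qed.

Lemma triple_skip s (Q : store -> Prop) : Q s -> triple Skip s 0 Q.
Proof. by []. Qed.

Lemma triple_set v e s (Q : store -> Prop) :
  Q (setv s v (ev inp s e)) -> triple (Assign v e) s (ecost e + 1) Q.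
Proof. by []. Qed.

Lemma triple_put a e1 e2 s (Q : store -> Prop) :
  Q (seta s a (ev inp s e1) (ev inp s e2)) ->
  triple (Put a e1 e2) s (ecost e1 + ecost e2 + 7) Q.
Proof. by []. Qed.

Lemma triple_seq c1 c2 s T1 T2 (Q1 Q : store -> Prop) :
  triple c1 s T1 Q1 -> (forall s', frame c1 s s' -> Q1 s' -> triple c2 s' T2 Q) ->
  triple (Seq c1 c2) s (T1 + T2) Q.
Proof.
move=> [cT q1] h; have [cT2 q2] := h _ (den_frame c1 s) q1.
by split=> //=; rewrite leq_add.
Qed.

Lemma triple_set_seq v e c s T (Q : store -> Prop) :
  triple c (setv s v (ev inp s e)) T Q -> triple (Seq (Assign v e) c) s (ecost e + 1 + T) Q.
Proof. by move=> [cT q]; split=> //=; rewrite leq_add2l. Qed.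

Lemma triple_put_seq a e1 e2 c s T (Q : store -> Prop) :
  triple c (seta s a (ev inp s e1) (ev inp s e2)) T Q ->
  triple (Seq (Put a e1 e2) c) s (ecost e1 + ecost e2 + 7 + T) Q.
Proof. by move=> [cT q]; split=> //=; rewrite leq_add2l. Qed.

Lemma triple_if e c1 c2 s T1 T2 (Q : store -> Prop) :
  (ev inp s e != 0 -> triple c1 s T1 Q) -> (ev inp s e = 0 -> triple c2 s T2 Q) ->
  triple (If e c1 c2) s (ecost e + 2 + maxn T1 T2) Q.
Proof.
rewrite /triple /=; case: eqP => [e0 _ /(_ e0) [cT q]|_ /(_ isT) [cT q] _];
  split=> //; lia.
Qed.

(** The invariant speaks of the store in which the counter has just been set
    to the first argument of I. *)
Lemma triple_for v e c s N T (I : nat -> store -> Prop) (Q : store -> Prop) :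
  ev inp s e = N -> ~~ assigns c v -> I 0 (setv s v 0) ->
  (forall i s', i < N -> frame (For v e c) s s' -> vars s' v = i -> I i s' ->
     triple c s' T (fun s'' => I i.+1 (setv s'' v i.+1))) ->
  (forall s', frame (For v e c) s s' -> I N s' -> Q s') ->
  triple (For v e c) s (ecost e + 2 + N * (T + 5)) Q.
Proof.
move=> eN vc I0 Istep IQ; rewrite /triple /= eN.
set f := loop v _; set s0 := setv s v 0.
have H i : i <= N ->
    [/\ frame (For v e c) s (iter i f s0), vars (iter i f s0) v = i
      & I i (iter i f s0)].
  elim: i => [_|i IH lt_i].
    split=> //=; last by rewrite /veq; case: (v).
    by split=> //= w; rewrite negb_or => /andP [/negPf ->].
  have [F ei Ii] := IH (ltnW lt_i); have [_ Q1] := Istep i _ lt_i F ei Ii.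
  have [F1 F2] := den_frame c (iter i f s0); rewrite iterS /f /loop -/f.
  rewrite F1 // ei; split=> //; last by rewrite /= /veq; case: (v).
  case: F => F3 F4; split=> /= w.
    by rewrite negb_or => /andP [w1 w2]; rewrite (negPf w1) F1 // F3 //= negb_or w1.
  by move=> w1; rewrite F2 // F4.
split; last by have [F _ IN] := H N (leqnn N); exact: IQ.
rewrite leq_add2l -[N in N * _]card_ord -sum_nat_const leq_sum // => i _.
have [F ei Ii] := H i (ltnW (ltn_ord i)).
by have [cT _] := Istep i _ (ltn_ord i) F ei Ii; rewrite leq_add2r.
Qed.

End Logic.

(** * The algorithm *)

Declare Scope cmd_scope.
Declare Scope expr_scope.
Delimit Scope cmd_scope with C.
Delimit Scope expr_scope with X.
Bind Scope expr_scope with expr.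
Bind Scope cmd_scope with cmd.
Coercion Var : var >-> expr.
Arguments Inp _%_X.
Arguments If _%_X (_ _)%_C.
Arguments For _ _%_X _%_C.
Notation "e1 + e2" := (Plus e1%X e2%X) : expr_scope.
Notation "e1 - e2" := (Minus e1%X e2%X) : expr_scope.
Notation "0" := (Cst 0) : expr_scope.
Notation "1" := (Cst 1) : expr_scope.
Notation "a .[ e ]" := (Get a e%X) : expr_scope.
Notation "v ::= e" := (Assign v e%X) (at level 60) : cmd_scope.
Notation "a @ e1 ::= e2" := (Put a e1%X e2%X)
  (at level 60, e1 at level 1, e2 at level 59) : cmd_scope.
Notation "c1 ;; c2" := (Seq c1%C c2%C)
  (at level 90, right associativity, format "c1 ;; '/' c2") : cmd_scope.

(** Tests are numbers: 1 when they hold, 0 otherwise. *)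
Definition eqe (e1 e2 : expr) : expr := (1 - ((e1 - e2) + (e2 - e1)))%X.
Definition lee (e1 e2 : expr) : expr := (1 - (e1 - e2))%X.

(** u and v run through the multiples of the two numbers; the smaller of them
    advances until they meet. *)
Definition lcm_block : cmd :=
  (Vu ::= Aord.[Va] ;; Vv ::= Vx + 1 ;;
   For Vw (Vn + Vq)
     (If (eqe Vu Vv) Skip
        (If (lee Vu Vv) (Vu ::= Vu + Aord.[Va]) (Vv ::= Vv + (Vx + 1)))))%C.

Definition quotient_block : cmd :=
  (Vq ::= 0 ;; Vp ::= Vn ;;
   For Vi Vm (If (lee Vp Vm) (Vq ::= Vq + 1 ;; Vp ::= Vp + Vn) Skip))%C.

(** l remains 0 until the walk along the table first returns to a. *)
Definition orbit_block (base size : expr) : cmd :=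
  (Vp ::= Va ;; Vl ::= 0 ;;
   For Vi size
     (Vp ::= Inp (base + Vp) ;;
      If (eqe (Vl + ((Vp - Va) + (Va - Vp))) 0) (Vl ::= Vi + 1) Skip))%C.

Definition orders_block : cmd :=
  (For Va Vn (orbit_block 0 Vn ;; Aord @ Va ::= Vl))%C.

Definition numbers_block : cmd :=
  (For Va Vm (orbit_block Vn Vm ;; Anum @ Vl ::= Anum.[Vl] + 1))%C.

(** The label of x + 1 is replaced by the label of u wherever it occurs. *)
Definition merge_block : cmd :=
  (Vold ::= Alab.[Vx + 1] ;; Vnew ::= Alab.[Vu] ;;
   For Vw (Vm + 1)
     (If (eqe (Alab.[Vw]) Vold) (Alab @ Vw ::= Vnew) Skip))%C.

Definition labels_block : cmd :=
  (For Vx (Vm + 1) (Alab @ Vx ::= Vx) ;;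
   For Va Vn (For Vx Vq (lcm_block ;; merge_block)))%C.

(** P is the number of candidates for label c: it is multiplied by the number of
    multiples of x + 1 from 0 to q, by adding it to s once for each of them. *)
Definition size_block : cmd :=
  (VP ::= 1 ;;
   For Vx Vq
     (If (eqe (Alab.[Vx + 1]) Vc)
        (Vs ::= 0 ;; Vp ::= 0 ;;
         For Vi (Vq + 1)
           (If (lee Vp Vq) (Vs ::= Vs + VP ;; Vp ::= Vp + (Vx + 1)) Skip) ;;
         VP ::= Vs)
        Skip))%C.

(** acc[k] receives the number of vertices of order k in the product of A and of
    the candidate; only the equations at the lengths labelled c are tested. *)
Definition check_block : cmd :=
  (For Vk (Vm + 1) (Aacc @ Vk ::= 0) ;;
   For Va Vn (For Vx Vq
     (lcm_block ;; Aacc @ Vu ::= Aacc.[Vu] + Ay.[Vx + 1])) ;;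
   Vok ::= 1 ;;
   For Vk (Vm + 1)
     (If (eqe (Alab.[Vk]) Vc)
        (If (eqe (Aacc.[Vk]) (Anum.[Vk])) Skip (Vok ::= 0)) Skip))%C.

(** The digits of the odometer are the quotients y[x + 1] / (x + 1) for the
    lengths x + 1 labelled c. *)
Definition next_block : cmd :=
  (Vcarry ::= 1 ;;
   For Vx Vq
     (If Vcarry
        (If (eqe (Alab.[Vx + 1]) Vc)
           (If (lee (Ay.[Vx + 1] + (Vx + 1)) Vq)
              (Ay @ (Vx + 1) ::= Ay.[Vx + 1] + (Vx + 1) ;; Vcarry ::= 0)
              (Ay @ (Vx + 1) ::= 0))
           Skip)
        Skip))%C.

(** Adding res to s once for each valid candidate multiplies res by the number
    of valid candidates. The odometer ends where it began, with y zero, ready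
    for the next label. *)
Definition class_block : cmd :=
  (size_block ;; Vs ::= 0 ;;
   For Vt VP
     (check_block ;; If Vok (Vs ::= Vs + Vres) Skip ;; next_block) ;;
   Vres ::= Vs)%C.

Definition main : cmd :=
  (If (lee Vn Vm)
     (quotient_block ;; orders_block ;; numbers_block ;; labels_block ;;
      Vres ::= 1 ;; For Vc (Vm + 1) class_block)
     Skip)%C.

Lemma ev_eqe inp s e1 e2 : ev inp s (eqe e1 e2) = (ev inp s e1 == ev inp s e2).
Proof. by rewrite /=; lia. Qed.

Lemma ev_lee inp s e1 e2 : ev inp s (lee e1 e2) = (ev inp s e1 <= ev inp s e2).
Proof. by rewrite /=; lia. Qed.

Lemma ecost_eqe e1 e2 : ecost (eqe e1 e2) = (ecost e1 + ecost e2).*2 + 5.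
Proof. by rewrite /=; lia. Qed.

Lemma ecost_lee e1 e2 : ecost (lee e1 e2) = ecost e1 + ecost e2 + 3.
Proof. by rewrite /=; lia. Qed.

Section Branches.
Variable inp : nat -> nat.

Lemma triple_if_eq e1 e2 c1 c2 s T1 T2 (Q : store -> Prop) :
  (ev inp s e1 = ev inp s e2 -> triple inp c1 s T1 Q) ->
  (ev inp s e1 <> ev inp s e2 -> triple inp c2 s T2 Q) ->
  triple inp (If (eqe e1 e2) c1 c2) s
    ((ecost e1 + ecost e2).*2 + 7 + maxn T1 T2) Q.
Proof.
move=> h1 h2; rewrite -[7]/(5 + 2) addnA -ecost_eqe.
by apply: triple_if; rewrite ev_eqe; case: (_ =P ev inp s e2) => // e _;
  [exact: h1 | exact: h2].
Qed.

Lemma triple_if_le e1 e2 c1 c2 s T1 T2 (Q : store -> Prop) :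
  (ev inp s e1 <= ev inp s e2 -> triple inp c1 s T1 Q) ->
  (ev inp s e2 < ev inp s e1 -> triple inp c2 s T2 Q) ->
  triple inp (If (lee e1 e2) c1 c2) s
    (ecost e1 + ecost e2 + 5 + maxn T1 T2) Q.
Proof.
move=> h1 h2; rewrite -[5]/(3 + 2) addnA -ecost_lee.
apply: triple_if; rewrite ev_lee; first by case: leqP => // e _; exact: h1.
by case: leqP => // e _; exact: h2.
Qed.

End Branches.

(* Simplification then leaves the tests to triple_if_eq and triple_if_le. *)
Opaque eqe lee.

(** * Mixed radix numerals *)

Section MixedRadix.
Variable r : nat -> nat.
Hypothesis r_gt0 : forall i, 0 < r i.

Definition weight i := \prod_(j < i) r j.
Definition digit t i := t %/ weight i %% r i.

Lemma weightS i : weight i.+1 = weight i * r i.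
Proof. exact: big_ord_recr. Qed.

Lemma weight_gt0 i : 0 < weight i.
Proof. by rewrite prodn_gt0. Qed.

Lemma dvdn_weight i j : i <= j -> weight i %| weight j.
Proof.
elim: j => [|j IH]; first by rewrite leqn0 => /eqP ->.
by rewrite leq_eqVlt ltnS weightS => /orP [/eqP -> |/IH/dvdn_mulr //]; rewrite weightS.
Qed.

Lemma digit0 i : digit 0 i = 0. Proof. by rewrite /digit div0n mod0n. Qed.

(** After weight k steps the odometer with k digits is back to zero. *)
Lemma digit_weight i k : i < k -> digit (weight k) i = 0.
Proof.
move=> /dvdn_weight; rewrite weightS => /dvdnP [z ->]; rewrite /digit.
by rewrite mulnCA mulKn ?weight_gt0 // modnMl.
Qed.

Lemma ltn_digit t i : digit t i < r i.
Proof. by rewrite ltn_mod. Qed.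

(** Position i receives a carry when all the lower digits wrap around. *)
Lemma digitS t i : digit t.+1 i =
  if weight i %| t.+1
  then if (digit t i).+1 < r i then (digit t i).+1 else 0
  else digit t i.
Proof.
rewrite /digit divnS ?weight_gt0 //; case: ifP => _; last by rewrite add0n.
rewrite add1n -addn1 -modnDml addn1; set d := _ %/ _ %% _.
have : d < r i by rewrite ltn_mod.
case: (ltngtP d.+1 (r i)) => [lt_d _|gt_d|e _]; last by rewrite e modnn.
  by rewrite modn_small.
by [].
Qed.

Lemma dvdn_weightS t i : (weight i.+1 %| t.+1) =
  (weight i %| t.+1) && ~~ ((digit t i).+1 < r i).
Proof.
have [dv|ndv] := boolP (weight i %| t.+1); last first.
  by apply/negbTE; apply: contra ndv; apply: dvdn_trans; exact: dvdn_weight.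
rewrite -[t.+1 in LHS](divnK dv) weightS mulnC dvdn_pmul2r ?weight_gt0 //.
have := digitS t i; rewrite dv /digit /dvdn => ->.
by case: ltnP.
Qed.

Lemma modn_weightS t i : t %% weight i.+1 = digit t i * weight i + t %% weight i.
Proof.
have w0 := weight_gt0 i; rewrite weightS /digit.
set w := weight i in w0 *.
rewrite {1}(divn_eq t w) {1}(divn_eq (t %/ w) (r i)) mulnDl -mulnA (mulnC (r i)).
rewrite -addnA modnMDl modn_small // (leq_trans (n := (t %/ w %% r i).+1 * w)) //.
  by rewrite mulSn addnC ltn_add2r ltn_mod.
by rewrite mulnC leq_mul2l ltn_mod r_gt0 orbT.
Qed.

Lemma digit_inj k t t' : t < weight k -> t' < weight k ->
  (forall i, i < k -> digit t i = digit t' i) -> t = t'.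
Proof.
move=> lt_t lt_t' ed; rewrite -(modn_small lt_t) -(modn_small lt_t').
elim: k ed {lt_t lt_t'} => [|k IH] ed; first by rewrite /weight big_ord0 !modn1.
by rewrite !modn_weightS ed // IH // => i lt_i; rewrite ed // ltnW.
Qed.

(** Distinct numbers below weight q have distinct digits, and there are as many
    of these numbers as vectors of digits. *)
Lemma sum_digits q N (F : {ffun 'I_q -> 'I_N.+1} -> nat) :
  (forall i, i < q -> r i <= N.+1) ->
  \sum_(t < weight q) F [ffun i : 'I_q => inord (digit t i)] =
  \sum_(d : {ffun 'I_q -> 'I_N.+1} | [forall i : 'I_q, d i < r i]) F d.
Proof.
move=> r_le; pose phi (t : 'I_(weight q)) : {ffun 'I_q -> 'I_N.+1} :=
  [ffun i : 'I_q => inord (digit t i)].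
have phiE t (i : 'I_q) : phi t i = digit t i :> nat.
  by rewrite ffunE inordK // (leq_trans (ltn_digit t i)) // r_le.
have phi_inj : injective phi.
  move=> t t' e; apply/ord_inj/(@digit_inj q) => // i lt_i.
  by rewrite -(phiE t (Ordinal lt_i)) e phiE.
pose D := [set d : {ffun 'I_q -> 'I_N.+1} | [forall i : 'I_q, d i < r i]].
have imD : phi @: setT = D.
  apply/eqP; rewrite eqEcard card_imset // cardsT card_ord; apply/andP; split.
    apply/subsetP => _ /imsetP [t _ ->]; rewrite inE; apply/forallP => i.
    by rewrite phiE ltn_digit.
  rewrite (eq_card (B := family (fun i : 'I_q => [pred v : 'I_N.+1 | v < r i]))).
    rewrite card_family foldrE big_map big_enum /= /weight leq_prod // => i _.
    have ri : r i <= N.+1 by apply: r_le.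
    rewrite (eq_card (B := [set widen_ord ri j | j in 'I_(r i)])) => [|v].
      rewrite card_imset ?card_ord // => j j' /(congr1 val) /= e; exact: ord_inj.
    apply/idP/imsetP => [lt_v|[j _ ->]]; last exact: (ltn_ord j).
    by exists (Ordinal lt_v) => //; apply: val_inj.
  by move=> d; rewrite inE; apply: eq_forallb => i; rewrite inE.
transitivity (\sum_(d in D) F d); last by apply: eq_bigl => d; rewrite inE.
by rewrite -imD big_imset /=; [apply: eq_bigl => t; rewrite inE | move=> ? ? _ _ /phi_inj].
Qed.

End MixedRadix.

(** * Correctness and cost of the blocks of the algorithm *)

(** Neither u nor v passes the lcm; as long as they differ, u / a + v / x grows
    by one in each round. *)
Definition lcm_inv a x i u v :=
  [/\ a %| u, x %| v, 0 < u <= lcmn a x, 0 < v <= lcmn a x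
    & u = v \/ u %/ a + v %/ x = i + 2].

(** The next multiple of a after u does not jump over a larger multiple. *)
Lemma dvdn_add_leq a u L : a %| u -> a %| L -> u < L -> u + a <= L.
Proof.
move=> au aL lt_u; have := dvdn_leq _ (dvdn_sub aL au); rewrite subn_gt0.
by move=> /(_ lt_u); lia.
Qed.

Lemma lcm_inv0 a x : 0 < a -> 0 < x -> lcm_inv a x 0 a x.
Proof.
move=> a0 x0; rewrite /lcm_inv !dvdnn !divnn a0 x0.
have l0 : 0 < lcmn a x by rewrite lcmn_gt0 a0.
by split=> //; [exact/dvdn_leq/dvdn_lcml | exact/dvdn_leq/dvdn_lcmr | right].
Qed.

Lemma lcm_inv_step a x i u v : 0 < a -> 0 < x -> lcm_inv a x i u v ->
  lcm_inv a x i.+1 (if u == v then u else if u <= v then u + a else u)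
                   (if u == v then v else if u <= v then v else v + x).
Proof.
move=> a0 x0 [au xv /andP [u0 uL] /andP [v0 vL] d].
have [e|ne] := eqVneq u v; first by split; rewrite ?u0 ?v0; last by left.
case: d => [e|d]; first by rewrite e eqxx in ne.
have [le_uv|lt_vu] := leqP u v.
  have le_u : u + a <= lcmn a x.
    by apply: dvdn_add_leq; rewrite ?dvdn_lcml //; apply: leq_trans vL; rewrite ltn_neqAle ne.
  split; rewrite ?dvdn_addl ?v0 ?addn_gt0 ?u0 //; right.
  by rewrite divnDr // divnn a0; lia.
have le_v : v + x <= lcmn a x.
  by apply: dvdn_add_leq; rewrite ?dvdn_lcmr //; apply: leq_trans uL.
split; rewrite ?dvdn_addl ?u0 ?addn_gt0 ?v0 //; right.
by rewrite divnDr // divnn x0; lia.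
Qed.

(** u / a and v / x are at most x and a, so that u and v have met. *)
Lemma lcm_inv_end a x i u v : 0 < a -> 0 < x -> a + x <= i ->
  lcm_inv a x i u v -> u = lcmn a x.
Proof.
move=> a0 x0 le_i [au xv /andP [u0 uL] /andP [v0 vL]].
have lc z : 0 < z -> z %| a * x -> lcmn a x %/ z <= (a * x) %/ z.
  by move=> _ _; apply: leq_div2r; exact: leq_lcmn_mul.
case=> [e|d].
  apply/eqP; rewrite eqn_leq uL dvdn_leq // dvdn_lcm au e xv //.
have ua := leq_trans (leq_div2r a uL) (lc a a0 (dvdn_mulr _ (dvdnn a))).
have vx := leq_trans (leq_div2r x vL) (lc x x0 (dvdn_mull _ (dvdnn x))).
by move: ua vx; rewrite mulKn // mulnK //; lia.
Qed.

Section Specs.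
Variables (inp : nat -> nat) (n m q : nat) (o : nat -> nat).
Hypotheses (o_gt0 : forall a, a < n -> 0 < o a) (o_le : forall a, a < n -> o a <= n).
Hypotheses (n_gt0 : 0 < n) (q_gt0 : 0 < q) (nq_le : n * q <= m).

Local Notation triple := (triple inp).

Lemma nDq_le : n + q <= m.+1.
Proof. by move: n_gt0 q_gt0 nq_le; nia. Qed.

Definition env (s : store) : Prop :=
  [/\ vars s Vn = n, vars s Vm = m, vars s Vq = q
    & forall a, a < n -> arrs s Aord a = o a].

Lemma env_frame c s s' : env s -> frame c s s' ->
  ~~ [|| assigns c Vn, assigns c Vm, assigns c Vq | writes c Aord] -> env s'.
Proof.
move=> [e1 e2 e3 eo] [F G]; rewrite !negb_or => /and4P [w1 w2 w3 w4].
by split; rewrite ?F // => a lt_a; rewrite G ?eo.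
Qed.

Lemma env_setv s v k : env s -> ~~ [|| veq Vn v, veq Vm v | veq Vq v] ->
  env (setv s v k).
Proof.
move=> [e1 e2 e3 eo]; rewrite !negb_or => /and3P [/negPf w1 /negPf w2 /negPf w3].
by split=> //=; rewrite ?w1 ?w2 ?w3.
Qed.

Lemma lcm_blockP s : env s -> vars s Va < n -> vars s Vx < q ->
  triple lcm_block s (60 * m.+1) (fun s' => vars s' Vu = lcmn (o (vars s Va)) (vars s Vx).+1).
Proof.
move=> Es lt_a lt_x; have [en em eq eo] := Es.
set a := o _; set x := (vars s Vx).+1.
have a0 : 0 < a by exact: o_gt0.
apply: triple_leq.
- apply/triple_set_seq/triple_set_seq.
  pose I i s' := lcm_inv a x i (vars s' Vu) (vars s' Vv).
  apply: (@triple_for _ _ _ _ _ (n + q) _ I) => //=.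
  + by rewrite en eq.
  + by rewrite /I /= eo // addn1; exact: lcm_inv0.
  + move=> i s' lt_i F ei Ii.
    have ea : arrs s' Aord (vars s' Va) = a by rewrite !F.1 //= F.2 //= eo.
    have ex : vars s' Vx + 1 = x by rewrite F.1 //= addn1.
    have := @lcm_inv_step a x _ _ _ a0 (ltn0Sn _) Ii; rewrite -ea -ex => Ii'.
    apply: triple_if_eq => /= [e1|/eqP/negPf e1]; rewrite e1 ?eqxx in Ii'.
      by apply: triple_skip; rewrite /I /= e1 -ea -ex.
    apply: triple_if_le => /= [e2|]; last rewrite ltnNge => /negPf e2.
      by rewrite e2 in Ii'; apply: triple_set; rewrite /I /= -ea -ex.
    by rewrite e2 in Ii'; apply: triple_set; rewrite /I /= -ea -ex.
  + move=> s' _; apply: lcm_inv_end => //; rewrite leq_add //; exact: o_le.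
- by rewrite /=; have := nDq_le; lia.
Qed.

Lemma n_le : n <= m.
Proof. by apply: leq_trans nq_le; rewrite leq_pmulr. Qed.

Lemma q_le : q <= m.
Proof. by apply: leq_trans nq_le; rewrite leq_pmull. Qed.

(** As n * q <= m, a pass over all the pairs costs O(m) bodies. *)
Lemma pair_cost c T : n * (c + q * T) <= (c + T) * m.
Proof.
have := n_le; move: nq_le => h1 h2; rewrite mulnDr mulnA mulnDl.
by rewrite leq_add // mulnC leq_mul2l ?h1 ?h2 orbT.
Qed.

Lemma lcm_le a x : a < n -> x < q -> lcmn (o a) x.+1 <= m.
Proof.
move=> lt_a lt_x; apply: leq_trans nq_le.
apply: leq_trans (leq_lcmn_mul _ _) _ => //; first exact: o_gt0.
by rewrite leq_mul // o_le.
Qed.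

Lemma merge_blockP s : vars s Vm = m ->
  triple merge_block s (60 * m.+1) (fun s' => forall w, w <= m ->
    arrs s' Alab w = if arrs s Alab w == arrs s Alab (vars s Vx).+1
                   then arrs s Alab (vars s Vu) else arrs s Alab w).
Proof.
move=> em; set lab := arrs s Alab; set old := lab _; set new := lab (vars s Vu).
apply: triple_leq.
- apply/triple_set_seq/triple_set_seq.
  pose I i s' := forall w, arrs s' Alab w =
    if (w < i) && (lab w == old) then new else lab w.
  apply: (@triple_for _ _ _ _ _ m.+1 _ I) => [|||i s' lt_i F ei Ii|s' _ Im w le_w] //=.
  + by rewrite em addn1.
  + have eo : vars s' Vold = old by rewrite F.1 //= addn1.
    have en : vars s' Vnew = new by rewrite F.1.
    have Ii1 w : w != i -> arrs s' Alab w =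
        if (w < i.+1) && (lab w == old) then new else lab w.
      by rewrite Ii ltnS [w <= i]leq_eqVlt => /negPf ->.
    have eli : arrs s' Alab i = lab i by rewrite Ii ltnn.
    apply: triple_if_eq => /=; rewrite ei eo eli => e.
      apply: triple_put; rewrite /I /= ei en => w.
      by case: eqP => [->|/eqP/Ii1 //]; rewrite ltnSn e eqxx.
    apply: triple_skip; rewrite /I /= => w; case: (eqVneq w i) => [->|/Ii1 //].
    by rewrite eli ltnSn; case: eqP.
  + by rewrite Im ltnS le_w.
- by rewrite /=; lia.
Qed.

Variable key : nat -> nat.
Hypothesis key_lcm : forall a x, a < n -> x < q -> key (lcmn (o a) x.+1) = key x.+1.

(** The label is at least as fine as the key, which will be lcm(., L): every
    merge identifies two labels with the same key. *)
Definition sound (lab : nat -> nat) : Prop :=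
  (forall w, w <= m -> lab w <= m) /\
  (forall w w', w <= m -> w' <= m -> lab w = lab w' -> key w = key w').

Definition joined (lab : nat -> nat) a x := lab (lcmn (o a) x.+1) = lab x.+1.

(** Relabelling is a function of the label, so that pairs joined earlier remain
    joined. *)
Lemma sound_merge lab lab' a x : a < n -> x < q -> sound lab ->
  (forall w, w <= m -> lab' w =
     if lab w == lab x.+1 then lab (lcmn (o a) x.+1) else lab w) ->
  [/\ sound lab', joined lab' a x
    & forall b y, b < n -> y < q -> joined lab b y -> joined lab' b y].
Proof.
move=> lt_a lt_x [lab_le lab_key] lab'E.
have le_l := lcm_le lt_a lt_x; have le_x : x.+1 <= m by apply: leq_trans q_le.
have ka := key_lcm lt_a lt_x.
split.
- split=> [w le_w|w w' le_w le_w']; first by rewrite lab'E //; case: ifP => _; exact: lab_le.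
  rewrite !lab'E //; case: eqP => e; case: eqP => e' h.
  + by apply: lab_key => //; rewrite e.
  + by rewrite (lab_key w x.+1) // -ka; exact: lab_key.
  + by rewrite (lab_key w' x.+1) // -ka; exact: lab_key.
  + exact: lab_key.
- by rewrite /joined !lab'E // eqxx; case: eqP.
- move=> b y lt_b lt_y; rewrite /joined => j.
  by rewrite !lab'E ?lcm_le ?(leq_trans lt_y q_le) // j.
Qed.

Lemma labels_blockP s : env s ->
  triple labels_block s (300 * m.+1 * m.+1) (fun s' => sound (arrs s' Alab) /\
    forall a x, a < n -> x < q -> joined (arrs s' Alab) a x).
Proof.
move=> Es; have [en em eq eo] := Es.
apply: triple_leq.
- apply: triple_seq.
    pose I i s' := forall w, w < i -> arrs s' Alab w = w.
    apply: (@triple_for _ _ _ _ _ m.+1 _ I _ _ _ _ _ (fun s' F => id)) => //=.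
      by rewrite em addn1.
    move=> i s' lt_i F ei Ii; apply: triple_put; rewrite /I /= ei => w.
    by rewrite ltnS leq_eqVlt; case: eqP => [->|_ /Ii].
  move=> s1 F1 lab1; have Es1 := env_frame Es F1 isT.
  pose I a s' := sound (arrs s' Alab) /\
    forall b x, b < a -> b < n -> x < q -> joined (arrs s' Alab) b x.
  apply: (@triple_for _ _ _ _ _ n _ I) => [|||a s2 lt_a F2 ea [Sa Ja]|s2 _ [Sn Jn]] //=.
  + by case: Es1.
  + split=> //; split=> [w le_w|w w' le_w le_w']; rewrite !lab1 //.
    by move=> ->.
  + have Es2 := env_frame Es1 F2 isT.
    pose J x s' := I a s' /\ forall y, y < x -> y < q -> joined (arrs s' Alab) a y.
    apply: (@triple_for _ _ _ _ _ q _ J)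
        => [|||x s3 lt_x F3 ex [[Sx Jx] Jax]|s3 F3 [[Sx Jx] Jax]] //=.
    * by case: Es2.
    * have Es3 := env_frame Es2 F3 isT.
      have ea3 : vars s3 Va = a by rewrite F3.1.
      apply: triple_seq; first by apply: lcm_blockP => //; rewrite ?ea3 ?ex.
      move=> s4 F4; rewrite ea3 ex => el.
      have em4 : vars s4 Vm = m by have [_ + _ _] := env_frame Es3 F4 isT.
      apply: triple_weak (merge_blockP em4) (leqnn _) _ => s5 F5.
      rewrite el !F4.1 // ex F4.2 // => lab5.
      have [S5 J5 mono] := sound_merge lt_a lt_x Sx lab5.
      split=> [|y] /=; first by split=> //= b y lt_ba lt_b lt_y; apply: mono => //; apply: Jx.
      by rewrite ltnS leq_eqVlt => /orP [/eqP -> //|lt_y lt_yq]; apply: mono => //; exact: Jax.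
    * split=> //= b x; rewrite ltnS leq_eqVlt => /orP [/eqP ->|lt_b].
        by move=> _ lt_x; exact: Jax.
      exact: Jx.
  + by split=> // a x lt_a; exact: Jn.
- rewrite /=; have := pair_cost 8 (120 * m.+1 + 5); nia.
Qed.

Variables (lab b : nat -> nat).

Definition radix c x := if lab x.+1 == c then (q %/ x.+1).+1 else 1.

Lemma radix_gt0 c x : 0 < radix c x.
Proof. by rewrite /radix; case: ifP. Qed.

Lemma size_blockP c s : env s -> arrs s Alab = lab -> vars s Vc = c ->
  triple size_block s (200 * m.+1 * m.+1)
    (fun s' => vars s' VP = weight (radix c) q).
Proof.
move=> Es elab ec; have [en em eq eo] := Es; apply: triple_leq.
- apply: triple_set_seq.
  pose I x s' := vars s' VP = weight (radix c) x.
  apply: (@triple_for _ _ _ _ _ q _ I) => [|||x s1 lt_x F1 ex Ix|s' _] //=.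
  + by rewrite /I /= /weight big_ord0.
  + have elab1 : arrs s1 Alab = lab by rewrite F1.2.
    have ec1 : vars s1 Vc = c by rewrite F1.1.
    have eq1 : vars s1 Vq = q by rewrite F1.1.
    have weightx : weight (radix c) x.+1 =
        weight (radix c) x * (if lab x.+1 == c then (q %/ x.+1).+1 else 1).
      exact: weightS.
    apply: triple_if_eq => /=; rewrite elab1 ec1 ex addn1 => e; last first.
      by apply: triple_skip; rewrite /I /= weightx Ix; case: eqP => //; rewrite muln1.
    rewrite e eqxx in weightx.
    apply/triple_set_seq/triple_set_seq; apply: triple_seq.
      pose J i s' := vars s' Vp = x.+1 * minn i (q %/ x.+1).+1 /\
        vars s' Vs = weight (radix c) x * minn i (q %/ x.+1).+1.
      apply: (@triple_for _ _ _ _ _ q.+1 _ J _ _ _ _ _ (fun s' F => id))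
          => [|||i s2 lt_i F2 ei [ep es]] //=.
      * by rewrite eq1 addn1.
      * by rewrite /J /= !muln0.
      * have eq2 : vars s2 Vq = q by rewrite F2.1.
        have ex2 : vars s2 Vx = x by rewrite F2.1.
        have eP2 : vars s2 VP = weight (radix c) x by rewrite F2.1.
        have H : (x.+1 * minn i (q %/ x.+1).+1 <= q) =
            (minn i (q %/ x.+1).+1 <= q %/ x.+1) by rewrite mulnC -leq_divRL.
        apply: triple_if_le => /=; rewrite ep eq2 ?ltnNge H => le_i.
          apply: triple_set_seq; apply: triple_set; rewrite /J /= ep es ex2 eP2.
          rewrite addn1 -!mulnSr; split; congr (_ * _); lia.
        by apply: triple_skip; rewrite /J /= ep es; split; congr (_ * _); lia.
    move=> s2 F2 [_ es]; apply: triple_set; rewrite /I /= es weightx.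
    by congr (_ * _); apply/minn_idPr; rewrite ltnS leq_div.
- rewrite /=; have := q_le; nia.
Qed.

(** y holds numbers of vertices rather than multiplicities, so that the
    convolution needs additions only. *)
Definition stores_multiples (d : nat -> nat) s :=
  forall x, x < q -> arrs s Ay x.+1 = x.+1 * d x.

(** After position i the carry tells whether all the digits below i wrap around,
    that is, whether weight i divides t.+1. *)
Lemma next_blockP c t s : env s -> arrs s Alab = lab -> vars s Vc = c ->
  stores_multiples (digit (radix c) t) s ->
  triple next_block s (200 * m.+1) (stores_multiples (digit (radix c) t.+1)).
Proof.
move=> Es elab ec Ys; have [en em eq eo] := Es; apply: triple_leq.
- apply: triple_set_seq.
  pose I i s' := vars s' Vcarry = (weight (radix c) i %| t.+1) /\
    stores_multiples (fun x =>
      if x < i then digit (radix c) t.+1 x else digit (radix c) t x) s'.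
  apply: (@triple_for _ _ _ _ _ q _ I) => [|||i s1 lt_i F1 ei [e1 Y1]|s' _ [_ Yq] x lt_x] //=.
  + by rewrite /I /= /weight big_ord0 dvd1n; split=> // x lt_x; exact: Ys.
  + have elab1 : arrs s1 Alab = lab by rewrite F1.2.
    have ec1 : vars s1 Vc = c by rewrite F1.1.
    have eq1 : vars s1 Vq = q by rewrite F1.1.
    have rP := radix_gt0 c.
    have dS := digitS rP t i; have wS := dvdn_weightS rP t i.
    have yi := Y1 i lt_i; rewrite ltnn in yi.
    have other (A : nat -> nat) : A i.+1 = i.+1 * digit (radix c) t.+1 i ->
        (forall j, j != i.+1 -> A j = arrs s1 Ay j) ->
        forall x, x < q -> A x.+1 = x.+1 *
          (if x < i.+1 then digit (radix c) t.+1 x else digit (radix c) t x).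
      move=> Ai Aj x lt_x; rewrite ltnS; case: (ltngtP x i) => [lt_xi|lt_ix|-> //].
        by rewrite Aj ?eqSS ?ltn_eqF // Y1 // lt_xi.
      by rewrite Aj ?eqSS ?gtn_eqF // Y1 // ltnNge (ltnW lt_ix).
    have keep : digit (radix c) t.+1 i = digit (radix c) t i ->
        forall x, x < q -> arrs s1 Ay x.+1 = x.+1 *
          (if x < i.+1 then digit (radix c) t.+1 x else digit (radix c) t x).
      by move=> ed; apply: other; rewrite ?yi ?ed.
    apply: triple_if => /=; rewrite e1;
        case: (boolP (_ %| _)) dS wS => //= dv dS wS _; last first.
      by apply: triple_skip; split=> /=; [rewrite e1 wS (negPf dv) | exact: keep].
    apply: triple_if_eq => /=; rewrite elab1 ec1 ei addn1 => e; last first.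
      have r1 : radix c i = 1 by rewrite /radix; case: eqP.
      have d0 u : digit (radix c) u i = 0 by rewrite /digit r1 modn1.
      apply: triple_skip; split=> /=; first by rewrite e1 wS r1 d0 dv.
      by apply: keep; rewrite !d0.
    have ri : radix c i = (q %/ i.+1).+1 by rewrite /radix e eqxx.
    have H : (i.+1 * digit (radix c) t i + i.+1 <= q) = ((digit (radix c) t i).+1 < radix c i).
      by rewrite -mulnSr mulnC -leq_divRL // ri.
    apply: triple_if_le => /=; rewrite ei addn1 yi eq1 ?ltnNge H => lt_d.
      apply: triple_put_seq; apply: triple_set; rewrite /I /= ei addn1 yi wS lt_d.
      split=> //; apply: (other (fun j => if j == i.+1 then _ else _)) => [|j /negPf -> //].
      by rewrite eqxx dS lt_d mulnSr.
    apply: triple_put; rewrite /I /= ei addn1 e1 wS dv (negPf lt_d).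
    split=> //; apply: (other (fun j => if j == i.+1 then _ else _)) => [|j /negPf -> //].
    by rewrite eqxx dS (negPf lt_d) muln0.
  + by rewrite Yq // lt_x.
- rewrite /=; have := q_le; nia.
Qed.

Lemma eq_conv (d d' : 'I_q -> nat) k : d =1 d' -> conv n o d k = conv n o d' k.
Proof. by move=> e; apply: eq_bigr => a _; apply: eq_bigr => i _; rewrite e. Qed.

Definition holds c (d : 'I_q -> nat) : bool :=
  [forall k : 'I_m.+1, (lab k == c) ==> (conv n o d k == b k)].

Lemma check_blockP c d s : env s -> arrs s Alab = lab -> arrs s Anum =1 b ->
  vars s Vc = c -> stores_multiples d s ->
  triple check_block s (400 * m.+1 * m.+1)
    (fun s' => vars s' Vok = holds c (fun i => d i)).
Proof.
move=> Es elab eb ec Ys; have [en em eq eo] := Es; apply: triple_leq.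
- apply: triple_seq.
    pose I i s' := forall k, k < i -> arrs s' Aacc k = 0.
    apply: (@triple_for _ _ _ _ _ m.+1 _ I _ _ _ _ _ (fun s' F => id)) => //=.
      by rewrite em addn1.
    move=> i s' lt_i F ei Ii; apply: triple_put; rewrite /I /= ei => k.
    by rewrite ltnS leq_eqVlt; case: eqP => [->|_ /Ii].
  move=> s1 F1 acc1; have Es1 := env_frame Es F1 isT.
  pose F a i k := (lcmn (o a) i.+1 == k) * (i.+1 * d i).
  apply: triple_seq.
    pose I a s' := forall k, k <= m ->
      arrs s' Aacc k = \sum_(a' < a) \sum_(i < q) F a' i k.
    apply: (@triple_for _ _ _ _ _ n _ I _ _ _ _ _ (fun s' F => id))
        => [||k le_k|a s2 lt_a F2 ea Ia] //=.
    - by case: Es1.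
    - by rewrite big_ord0 acc1.
    have Es2 := env_frame Es1 F2 isT.
    pose J x s' := forall k, k <= m -> arrs s' Aacc k =
      \sum_(a' < a) \sum_(i < q) F a' i k + \sum_(i < x) F a i k.
    apply: (@triple_for _ _ _ _ _ q _ J) => [||k le_k|x s3 lt_x F3 ex Jx|s3 _ Jq k le_k] //=.
    - by case: Es2.
    - by rewrite big_ord0 addn0 Ia.
    - have Es3 := env_frame Es2 F3 isT.
      have ea3 : vars s3 Va = a by rewrite F3.1.
      apply: triple_seq; first by apply: lcm_blockP => //; rewrite ?ea3 ?ex.
      move=> s4 F4; rewrite ea3 ex => el.
      have y4 : arrs s4 Ay x.+1 = x.+1 * d x.
        by rewrite F4.2 // F3.2 // F2.2 // F1.2 // Ys.
      have x4 : vars s4 Vx = x by rewrite F4.1.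
      apply: triple_put; rewrite /J /= el x4 addn1 y4 F4.2 // => k le_k.
      have -> : \sum_(i < x.+1) F a i k = \sum_(i < x) F a i k + F a x k.
        exact: big_ord_recr.
      have -> : F a x k = (k == lcmn (o a) x.+1) * (x.+1 * d x).
        by rewrite /F eq_sym.
      by rewrite addnA; case: eqP => [->|_]; rewrite /= Jx ?mul1n ?addn0 ?lcm_le.
    - by rewrite Jq // big_ord_recr.
  move=> s2 F2 acc2; apply: triple_set_seq.
  have eacc k : k <= m -> arrs s2 Aacc k = conv n o (fun i : 'I_q => d i) k.
    by move=> le_k; rewrite acc2.
  have elab2 : arrs s2 Alab = lab by rewrite F2.2 // F1.2.
  have eb2 : arrs s2 Anum =1 b by move=> k; rewrite F2.2 // F1.2.
  have ec2 : vars s2 Vc = c by rewrite F2.1 // F1.1.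
  have em2 : vars s2 Vm = m by rewrite F2.1 // F1.1.
  pose I i s' := vars s' Vok = [forall k : 'I_m.+1, (k < i) ==>
    ((lab k == c) ==> (conv n o (fun i : 'I_q => d i) k == b k))].
  have IS i : i < m.+1 ->
      [forall k : 'I_m.+1, (k < i.+1) ==>
        ((lab k == c) ==> (conv n o (fun i : 'I_q => d i) k == b k))] =
      [forall k : 'I_m.+1, (k < i) ==>
        ((lab k == c) ==> (conv n o (fun i : 'I_q => d i) k == b k))] &&
      ((lab i == c) ==> (conv n o (fun i : 'I_q => d i) i == b i)).
    move=> lt_i; apply/forallP/andP => [H|[/forallP H Hi] k].
      split; last by have := H (Ordinal lt_i); rewrite ltnSn.
      by apply/forallP => k; apply/implyP => lt_k; move: (H k); rewrite ltnS ltnW.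
    apply/implyP; rewrite ltnS leq_eqVlt => /orP [/eqP ->|lt_k]; first exact: Hi.
    by have := H k; rewrite lt_k.
  apply: (@triple_for _ _ _ _ _ m.+1 _ I) => [|||i s3 lt_i F3 ei Ii|s3 _] //=.
  + by rewrite em2 addn1.
  + by rewrite /I /=; case: forallP => // -[].
  + have elab3 : arrs s3 Alab = lab by rewrite F3.2.
    have eacc3 : arrs s3 Aacc i = conv n o (fun i : 'I_q => d i) i.
      by rewrite F3.2 //= eacc.
    have eb3 : arrs s3 Anum i = b i by rewrite F3.2 //= eb2.
    have ec3 : vars s3 Vc = c by rewrite F3.1.
    have := IS i lt_i; move: Ii; rewrite /I => Ii IiS.
    apply: triple_if_eq => /=; rewrite elab3 ec3 ei => e; last first.
      by apply: triple_skip; rewrite /= IiS Ii; case: eqP => //; rewrite andbT.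
    apply: triple_if_eq => /=; rewrite ei eacc3 eb3 => e'.
      by apply: triple_skip; rewrite /= IiS Ii e' eqxx implybT andbT.
    by apply: triple_set; rewrite /= IiS e eqxx; case: eqP => // _; rewrite andbF.
  + rewrite /I => ->; congr nat_of_bool; apply: eq_forallb => k.
    by rewrite ltn_ord.
- rewrite /=; have := pair_cost 8 (60 * m.+1 + 33); nia.
Qed.

(** The candidates for label c are counted through their digits, a number t
    standing for the candidate at which the odometer is after t steps. *)
Definition class_count c : nat :=
  \sum_(t < weight (radix c) q) holds c (fun i => digit (radix c) t i).

Lemma class_blockP c s : env s -> arrs s Alab = lab -> arrs s Anum =1 b ->
  vars s Vc = c -> stores_multiples (fun _ => 0) s ->
  triple class_block s (2000 * m.+1 * m.+1 * weight (radix c) q)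
    (fun s' => stores_multiples (fun _ => 0) s' /\
               vars s' Vres = vars s Vres * class_count c).
Proof.
move=> Es elab eb ec Ys; have [en em eq eo] := Es; apply: triple_leq.
- apply: triple_seq (size_blockP Es elab ec) _ => s1 F1 eW.
  have Es1 := env_frame Es F1 isT.
  apply: triple_set_seq; apply: triple_seq.
    pose I t s' := stores_multiples (digit (radix c) t) s' /\
      vars s' Vs = vars s Vres * \sum_(t' < t) holds c (fun i => digit (radix c) t' i).
    apply: (@triple_for _ _ _ _ _ (weight (radix c) q) _ I _ _ _ _ _ (fun s' F => id))
        => [|||] //=.
      split=> /= [x lt_x|]; last by rewrite big_ord0 muln0.
      by rewrite /= F1.2 // Ys // digit0.
    move=> t s2 lt_t F2 et [Yt est].
    have Es2 := env_frame (env_setv 0 Es1 (v := Vs) isT) F2 isT.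
    have elab2 : arrs s2 Alab = lab by rewrite F2.2 //= F1.2.
    have eb2 : arrs s2 Anum =1 b by move=> k; rewrite F2.2 //= F1.2.
    have ec2 : vars s2 Vc = c by rewrite F2.1 //= F1.1.
    have er2 : vars s2 Vres = vars s Vres by rewrite F2.1 //= F1.1.
    apply: triple_seq (check_blockP Es2 elab2 eb2 ec2 Yt) _ => s3 F3 ok3.
    have Es3 := env_frame Es2 F3 isT.
    set ok := holds c _ in ok3.
    apply: (triple_seq (Q1 := fun s' => vars s' Vs = vars s2 Vs + ok * vars s2 Vres)).
      apply: triple_if => /=; rewrite ok3; case: (ok) => // _.
        by apply: triple_set; rewrite /= !F3.1 // mul1n.
      by apply: triple_skip; rewrite F3.1 // addn0.
    move=> s4 F4 es4; have Es4 := env_frame Es3 F4 isT.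
    apply: triple_weak (next_blockP (c := c) (t := t) Es4 _ _ _) (leqnn _) _.
    - by rewrite F4.2 // F3.2.
    - by rewrite F4.1 // F3.1.
    - by move=> x lt_x; rewrite F4.2 // F3.2 // Yt.
    move=> s5 F5 Y5; split=> //=.
    by rewrite F5.1 // es4 est er2 big_ord_recr /= mulnDr -/ok (mulnC (ok : nat)).
  move=> s2 F2 [Y2 es2]; apply: triple_set; split=> /= [x lt_x|]; last by rewrite es2.
  by rewrite /= Y2 // digit_weight //; exact: radix_gt0.
- rewrite /=; have := weight_gt0 (radix_gt0 c) q; set W := weight _ q.
  case: W => // W _; nia.
Qed.

Lemma classes_loopP W s : env s -> arrs s Alab = lab -> arrs s Anum =1 b ->
  vars s Vres = 1 -> stores_multiples (fun _ => 0) s ->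
  (forall c, weight (radix c) q <= W) ->
  triple (For Vc (Vm + 1) class_block) s (3000 * m.+1 * m.+1 * m.+1 * W)
    (fun s' => vars s' Vres = \prod_(c < m.+1) class_count c).
Proof.
move=> Es elab eb er Ys leW; have [en em eq eo] := Es; apply: triple_leq.
- pose I c s' := stores_multiples (fun _ => 0) s' /\
    vars s' Vres = \prod_(c' < c) class_count c'.
  apply: (@triple_for _ _ _ _ _ m.+1 (2000 * m.+1 * m.+1 * W) I)
      => [|||c s1 lt_c F1 ec [Y1 e1]|s1 _ []] //=.
  + by rewrite em addn1.
  + by split=> //=; rewrite big_ord0.
  + have Es1 := env_frame Es F1 isT.
    have elab1 : arrs s1 Alab = lab by rewrite F1.2.
    have eb1 : arrs s1 Anum =1 b by move=> k; rewrite F1.2.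
    apply: triple_weak (class_blockP Es1 elab1 eb1 ec Y1) _ _.
      by rewrite leq_mul2l leW orbT.
    by move=> s2 F2 [Y2 e2]; split=> //=; rewrite e2 e1 big_ord_recr.
- have W0 : 0 < W by apply: leq_trans (leW 0); exact: weight_gt0 (radix_gt0 0) q.
  by rewrite /=; case: W W0 {leW} => // W _; nia.
Qed.

End Specs.

(** * The quotient and the tables of orders *)

Section Tables.
Variable inp : nat -> nat.
Local Notation triple := (triple inp).

Lemma quotient_blockP s n m : 0 < n -> vars s Vn = n -> vars s Vm = m ->
  triple quotient_block s (60 * m.+1) (fun s' => vars s' Vq = m %/ n).
Proof.
move=> n0 en em; apply: triple_leq.
- apply/triple_set_seq/triple_set_seq.
  pose I i s' := vars s' Vq = minn i (m %/ n) /\ vars s' Vp = n * (vars s' Vq).+1.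
  apply: (@triple_for _ _ _ _ _ m _ I) => [||| i s' lt_i F ei [eq ep]|s' _ []] //=.
  + by rewrite /I /= en muln1 min0n.
  + have H : (n * (minn i (m %/ n)).+1 <= m) = (minn i (m %/ n) < m %/ n).
      by rewrite mulnC -leq_divRL.
    apply: triple_if_le => /=; rewrite ep eq F.1 //= em ?ltnNge H => lt_q.
      apply: triple_set_seq; apply: triple_set.
      by rewrite /I /= ep eq F.1 //= en; split; lia.
    by apply: triple_skip; rewrite /I /= ep eq; split; lia.
  + by move=> -> _; apply/minn_idPr/leq_div.
- by rewrite /=; lia.
Qed.

Section Orbit.
Variables (G : finType) (f : G -> G) (N : nat) (e : G -> 'I_N) (bs : nat).
Variables (eb ez : expr).
Hypotheses (injf : injective f) (inje : injective e) (leG : #|G| <= N).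
Hypothesis table : forall x, inp (bs + e x) = e (f x).
Hypotheses (cb : ecost eb = 1) (cz : ecost ez = 1).

Lemma orbit_blockP s x : 
  (forall s', vars s' Vn = vars s Vn -> ev inp s' eb = bs) ->
  ev inp (setv (setv s Vp (vars s Va)) Vl 0) ez = N -> vars s Va = e x ->
  triple (orbit_block eb ez) s (60 * N.+1) (fun s' => vars s' Vl = order f x).
Proof.
move=> eb_ ez_ ea; apply: triple_leq.
- apply/triple_set_seq/triple_set_seq.
  pose I i s' := vars s' Vp = e (iter i f x) /\
    vars s' Vl = if order f x <= i then order f x else 0.
  apply: (@triple_for _ _ _ _ _ N _ I) => [||| i s' lt_i F ei [ep el]|s' _ [_ ->]] //=.
  + by rewrite /I /= ea leqNgt order_gt0.
  + have eb' : ev inp s' eb = bs by apply: eb_; rewrite F.1.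
    apply: triple_set_seq; rewrite /= eb' ep table -iterS.
    have e0 : (e (iter i.+1 f x) - e x + (e x - e (iter i.+1 f x)) = 0) <->
        order f x %| i.+1.
      rewrite -iter_fix_order //; split=> [H|/eqP ->]; last by rewrite subnn.
      by apply/eqP/inje/ord_inj; lia.
    have ea' : vars s' Va = e x by rewrite F.1.
    apply: triple_if_eq; rewrite /= ea' el.
      case: leqP => [le_i /eqP|lt_i' /=].
        by rewrite addn_eq0 eqn0Ngt order_gt0.
      rewrite add0n => /e0 d.
      apply: triple_set; rewrite /I /= ei; split=> //.
      by have := dvdn_leq (ltn0Sn i) d; rewrite addn1; case: leqP => //; lia.
    case: leqP => [le_i _|lt_i' /= ne].
      by apply: triple_skip; rewrite /I /= el le_i leqW.
    apply: triple_skip; rewrite /I /= el leqNgt lt_i' /=; split=> //.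
    case: leqP => // le_i; case: ne; rewrite add0n; apply/e0.
    by rewrite (_ : order f x = i.+1) //; lia.
  + by rewrite (leq_trans (order_le_card f x) leG).
- by rewrite /= cb cz; lia.
Qed.

End Orbit.

Lemma orders_blockP (G : finType) (f : G -> G) n (e : G -> 'I_n) (o : nat -> nat) s :
  injective f -> bijective e -> (forall x, inp (e x) = e (f x)) ->
  (forall x, o (e x) = order f x) -> vars s Vn = n ->
  triple orders_block s (100 * n.+1 * n.+1)
    (fun s' => forall a, a < n -> arrs s' Aord a = o a).
Proof.
move=> injf bije table oE en.
have leG : #|G| <= n by rewrite -[n]card_ord; exact: leq_card (bij_inj bije).
have [e' _ e'K] := bije.
apply: triple_leq.
- pose I i s' := forall a, a < i -> arrs s' Aord a = o a.
  apply: (@triple_for _ _ _ _ _ n _ I) => //= i s' lt_i F ei Ii.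
  have ex := e'K (Ordinal lt_i).
  apply: triple_seq.
    apply: (@orbit_blockP _ f n e 0 0 Vn injf (bij_inj bije) leG _ _ _ s'
        (e' (Ordinal lt_i))) => //=.
      by rewrite F.1.
    by rewrite ei ex.
  move=> s'' F' el; apply: triple_put; rewrite /I /= F'.1 //= ei => a.
  rewrite ltnS leq_eqVlt => /orP [/eqP ->|lt_a].
    by rewrite eqxx el -oE ex.
  by rewrite ltn_eqF // F'.2 // Ii.
- by rewrite /=; nia.
Qed.

Lemma numbers_blockP (G : finType) (g : G -> G) m n (e : G -> 'I_m) s :
  injective g -> bijective e -> (forall x, inp (n + e x) = e (g x)) ->
  vars s Vn = n -> vars s Vm = m -> (forall k, arrs s Anum k = 0) ->
  triple numbers_block s (100 * m.+1 * m.+1)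
    (fun s' => forall k, arrs s' Anum k = norder g k).
Proof.
move=> injg bije table en em num0.
have leG : #|G| <= m by rewrite -[m]card_ord; exact: leq_card (bij_inj bije).
have [e' eK e'K] := bije.
apply: triple_leq.
- pose I i s' := forall k, arrs s' Anum k = \sum_(y | e y < i) (order g y == k).
  apply: (@triple_for _ _ _ _ _ m _ I) => [||k|i s' lt_i F ei Ii|s' _ Im k] //=.
  + by rewrite num0 big_pred0.
  + have ex := e'K (Ordinal lt_i); set x := e' _ in ex.
    apply: triple_seq.
      apply: (@orbit_blockP _ g m e n Vn Vm injg (bij_inj bije) leG _ _ _ s' x) => //=.
      * by move=> s1 ->; rewrite F.1.
      * by rewrite F.1.
      * by rewrite ei ex.
    move=> s'' F' el; apply: triple_put; rewrite /I /= el => k.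
    rewrite !F'.2 // !Ii addn1 [RHS](bigD1 x) /=; last by rewrite ex /=.
    rewrite [X in _ = _ + X](eq_bigl (fun y => e y < i)) => [|y].
      case: eqP => [->|]; first by rewrite eqxx addnC addn1.
      by rewrite eq_sym => /eqP/negPf ->; rewrite add0n.
    rewrite ltnS -(inj_eq (bij_inj bije)) ex -val_eqE /= ltn_neqAle andbC.
    by [].
  + rewrite Im norder_sum; apply: eq_bigl => y; exact: ltn_ord.
- by rewrite /=; nia.
Qed.
End Tables.

(** * Counting class by class *)

Section ClassSolutions.
Variables (n m q : nat) (o lab b : nat -> nat).
Hypothesis lab_joined : forall a x, a < n -> x < q ->
  lab (lcmn (o a) x.+1) = lab x.+1.

(** A vector supported on the labels in P is forced to be 0 elsewhere by a radix
    equal to 1. *)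
Definition support_radix (P : pred nat) x :=
  if P (lab x.+1) then (q %/ x.+1).+1 else 1.

Definition class_solutions (P : pred nat) : {set {ffun 'I_q -> 'I_q.+1}} :=
  [set d : {ffun 'I_q -> 'I_q.+1} |
    [forall i : 'I_q, d i < support_radix P i] &&
    [forall k : 'I_m.+1, P (lab k) ==> (conv n o (fun i => d i) k == b k)]].

Lemma card_class_solutions c : #|class_solutions (pred1 c)| = class_count n m q o lab b c.
Proof.
have r0 := radix_gt0 q lab c.
have r_le i : i < q -> radix q lab c i <= q.+1.
  by rewrite /radix; case: ifP => // _ _; rewrite ltnS leq_div.
transitivity (\sum_(d : {ffun 'I_q -> 'I_q.+1} |
    [forall i : 'I_q, d i < radix q lab c i]) holds n m o lab b c (fun i => d i)).
  rewrite -sum1_card [RHS]big_mkcond [LHS]big_mkcond; apply: eq_bigr => d _.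
  rewrite inE /holds /support_radix /radix /=.
  by case: [forall i : 'I_q, _]; case: [forall k : 'I_m.+1, _].
rewrite -(sum_digits r0 (fun d => holds n m o lab b c (fun i => d i)) r_le).
apply: eq_bigr => t _; congr nat_of_bool; apply: eq_forallb => k.
congr (_ ==> (_ == _)); apply: eq_conv => i.
by rewrite ffunE inordK // (leq_trans (ltn_digit r0 t i)) // r_le.
Qed.

(** The equation at k involves only unknowns with the label of k, because
    lcm(o a, x) has the label of x. *)
Lemma conv_class (d d' : 'I_q -> nat) k :
  (forall i : 'I_q, lab i.+1 = lab k -> d i = d' i) -> conv n o d k = conv n o d' k.
Proof.
move=> e; apply: eq_bigr => a _; apply: eq_bigr => i _.
by case: eqP => //= ek; rewrite e // -ek lab_joined.
Qed.

(** The systems of disjoint sets of labels share no unknown, so that their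
    solutions combine freely. *)
Lemma card_class_solutionsU (P1 P2 : pred nat) :
  (forall c, ~~ (P1 c && P2 c)) ->
  #|class_solutions (predU P1 P2)| = #|class_solutions P1| * #|class_solutions P2|.
Proof.
move=> disj; rewrite -cardsX.
pose f (u : {ffun 'I_q -> 'I_q.+1} * {ffun 'I_q -> 'I_q.+1}) :=
  [ffun i : 'I_q => if P1 (lab i.+1) then u.1 i else u.2 i].
have P2F c : P1 c -> P2 c = false by move=> h; have := disj c; rewrite h => /negPf.
have zero P (d : {ffun 'I_q -> 'I_q.+1}) (i : 'I_q) : d \in class_solutions P ->
    ~~ P (lab i.+1) -> d i = ord0.
  rewrite inE => /andP [/forallP /(_ i)]; rewrite /support_radix => + _ /negPf nP.
  by rewrite nP ltnS leqn0 => /eqP e; apply: val_inj.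
have f_inj : {in setX (class_solutions P1) (class_solutions P2) &, injective f}.
  move=> [d1 d2] [e1 e2] /setXP [/= hd1 hd2] /setXP [/= he1 he2] /ffunP e.
  congr (_, _); apply/ffunP => i; have := e i; rewrite !ffunE /=; case: ifPn => // p.
    by rewrite (zero _ _ _ hd1) // (zero _ _ _ he1).
  by rewrite (zero _ _ _ hd2) ?P2F // (zero _ _ _ he2) ?P2F.
rewrite -(card_in_imset f_inj); apply: eq_card => d.
pose cut (P : pred nat) := [ffun i : 'I_q => if P (lab i.+1) then d i else ord0].
apply/idP/imsetP => [|[[d1 d2] /setXP [/= h1 h2] ->]].
  rewrite inE => /andP [/forallP hd /forallP ed].
  have cutP (P : pred nat) : (forall c, P c -> P1 c || P2 c) -> cut P \in class_solutions P.
    move=> sP; rewrite inE; apply/andP; split; apply/forallP => i.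
      rewrite ffunE /support_radix; case: ifP => // p.
      by have := hd i; rewrite /support_radix /= (sP _ p).
    apply/implyP => p; have := ed i; rewrite /= (sP _ p) => /eqP <-; apply/eqP.
    by apply: conv_class => j ej; rewrite ffunE ej p.
  exists (cut P1, cut P2).
    by apply/setXP; split; apply: cutP => c ->; rewrite ?orbT.
  apply/ffunP => i; rewrite ffunE /= !ffunE; case: ifP => [-> //|n1]; case: ifP => // n2.
  apply: val_inj; have := hd i; rewrite /support_radix /= n1 n2 ltnS leqn0.
  by move/eqP.
move: (h1) (h2); rewrite !inE => /andP [/forallP r1 /forallP q1] /andP [/forallP r2 /forallP q2].
apply/andP; split; apply/forallP => i.
  rewrite ffunE /support_radix /=; have := r1 i; have := r2 i.
  by rewrite /support_radix; case: (P1 (lab i.+1)).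
apply/implyP => /= /orP [p|p].
  have := q1 i; rewrite p /= => /eqP <-; apply/eqP; apply: conv_class => j ej.
  by rewrite ffunE ej p.
have := q2 i; rewrite p /= => /eqP <-; apply/eqP; apply: conv_class => j ej.
by rewrite ffunE ej; case: ifP => // p1; rewrite P2F in p.
Qed.

Lemma card_solutions : (forall w, w <= m -> lab w <= m) -> q <= m ->
  #|solutions n m q o b| = \prod_(c < m.+1) class_count n m q o lab b c.
Proof.
move=> lab_le le_qm.
have H j : #|class_solutions (fun l => l < j)| =
    \prod_(c < j) class_count n m q o lab b c.
  elim: j => [|j IH].
    rewrite big_ord0 (eq_card (B := pred1 [ffun=> ord0])) ?card1 // => d.
    rewrite !inE; apply/idP/eqP => [/andP [/forallP h _]|->].
      apply/ffunP => i; rewrite ffunE; apply: val_inj => /=.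
      by have := h i; rewrite /support_radix ltn0 ltnS leqn0 => /eqP.
    by apply/andP; split; apply/forallP => i //; rewrite ffunE.
  rewrite big_ord_recr /= -IH -card_class_solutions -card_class_solutionsU.
    apply: eq_card => d; rewrite !inE; congr (_ && _); apply: eq_forallb => i.
      by rewrite /support_radix /= ltnS [_ <= j]leq_eqVlt orbC.
    by rewrite /= ltnS [_ <= j]leq_eqVlt orbC.
  by move=> c /=; case: eqP => [->|]; rewrite ?ltnn ?andbF.
rewrite -H; apply: eq_card => d; rewrite !inE; congr (_ && _); apply: eq_forallb => i.
  rewrite /support_radix ltnS lab_le //; exact: leq_trans (ltn_ord i) le_qm.
by rewrite ltnS lab_le // -ltnS.
Qed.

(** The length x contributes a factor q / x + 1 <= q, except x = 1 which
    contributes q + 1 <= 2 q. *)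
Lemma weight_radix_le (c : nat) :
  weight (radix q lab c) q <= 2 * q ^ \sum_(x < q) (lab x.+1 == c).
Proof.
suff H i : i <= q ->
    weight (radix q lab c) i <= (0 < i).+1 * q ^ \sum_(x < i) (lab x.+1 == c).
  have := H q (leqnn q); case: (q) => // _; by rewrite /weight !big_ord0.
elim: i => [_|i IH lt_i]; first by rewrite /weight !big_ord0.
rewrite weightS big_ord_recr /= expnD.
have {IH} := IH (ltnW lt_i); set w := weight _ i; set e := \sum_(_ < i) _.
have q0 : 0 < q by case: (q) lt_i.
rewrite /radix; case: eqP => _ le_w; last first.
  by rewrite !muln1 (leq_trans le_w) // leq_mul2r ltnS leq_b1 orbT.
rewrite expn1; case: i lt_i e w le_w => [|i] lt_i e w le_w.
  rewrite divn1 mulnA; apply: leq_trans (leq_mul le_w (leqnn _)) _.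
  by move: (q ^ e) => z /=; nia.
rewrite mulnA leq_mul // (leq_trans (n := (q %/ 2).+1)) //.
  by rewrite ltnS leq_div2l.
by have := leq_divM q 2; lia.
Qed.

End ClassSolutions.

(** x |-> gcd(x, L) is injective on a class, since x L = gcd(x, L) lcm(x, L), and
    its values are divisors of L. *)
Lemma count_lcm_class (lab : nat -> nat) q m L (c : nat) : 0 < L -> q <= m ->
  (forall w w', w <= m -> w' <= m -> lab w = lab w' -> lcmn w L = lcmn w' L) ->
  \sum_(x < q) (lab x.+1 == c) <= ndiv L.
Proof.
move=> L0 le_qm key.
pose s := [seq x <- iota 1 q | lab x == c].
have -> : \sum_(x < q) (lab x.+1 == c) = size s.
  transitivity (\sum_(1 <= x < q.+1) (lab x == c)); first by rewrite big_add1 big_mkord.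
  rewrite /index_iota subSS subn0 size_filter -sum1_count [RHS]big_mkcond.
  by apply: eq_bigr => x _; case: ifP.
rewrite -(size_map (gcdn^~ L)) /ndiv; apply: uniq_leq_size => [|d /mapP [x _ ->]].
  rewrite map_inj_in_uniq ?filter_uniq ?iota_uniq // => x y.
  rewrite !mem_filter !mem_iota add1n !ltnS => /and3P [/eqP lx x0 xq] /and3P [/eqP ly y0 yq] eg.
  have el : lcmn x L = lcmn y L.
    by apply: key; rewrite ?lx ?ly // (leq_trans _ le_qm).
  have ex := muln_lcm_gcd x L; have ey := muln_lcm_gcd y L.
  by apply/eqP; rewrite -(eqn_pmul2r L0) -ex -ey el eg.
by rewrite -dvdn_divisors // dvdn_gcdr.
Qed.

(** * The whole program *)

Lemma encodes_table (G : digraph) (f : G -> G) u : perm_digraph f -> encodes G u ->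
  size u = dsize G /\
  exists2 e : G -> 'I_(dsize G), bijective e & forall x, nth 0 u (e x) = e (f x).
Proof.
move=> [_ df] [su [e bije du]]; split=> //; exists e => // x; apply/eqP.
by rewrite -du df.
Qed.

(** The enumeration of the candidates accounts for at most
    3000 (m + 1)^3 * 2 q^div(L) steps; what remains of the constant covers the
    quadratic preparation. *)
Lemma mainP (A B : digraph) (f : A -> A) (g : B -> B) (u v : seq nat) :
  perm_digraph f -> perm_digraph g -> encodes A u -> encodes B v ->
  0 < dsize A <= dsize B ->
  let m := dsize B in let q := m %/ dsize A in
  triple (nth 0 (u ++ v)) main (init (size u) (size v))
    (4000 * m.+1 * m.+1 * m.+1 * (2 * q ^ ndiv (lcm_seq (cycle_lengths A))))
    (fun s => number_of_solutions A B (vars s Vres)).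
Proof.
move=> pf pg encA encB /andP [n_gt0 le_nm] m q.
have [injf _] := pf; have [injg _] := pg.
have [su [e bije tabA]] := encodes_table pf encA.
have [sv [e' bije' tabB]] := encodes_table pg encB.
rewrite su sv; set n := dsize A in su e bije tabA le_nm n_gt0 q *.
set inp := nth 0 (u ++ v); set L := lcm_seq _.
have q_gt0 : 0 < q by rewrite divn_gt0.
have nq_le : n * q <= m by rewrite mulnC leq_divM.
have [einv eK einvK] := bije.
pose o a := if insub a is Some i then order f (einv i) else 0.
have oE x : o (e x) = order f x by rewrite /o valK eK.
have oP a : a < n -> exists x, o a = order f x.
  by move=> lt_a; exists (einv (Ordinal lt_a)); rewrite -oE einvK.
have o_gt0 a : a < n -> 0 < o a by move=> /oP [x ->]; exact: order_gt0.
have o_le a : a < n -> o a <= n by move=> /oP [x ->]; exact: order_le_card.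
have L_gt0 : 0 < L.
  rewrite /L /lcm_seq big_seq; elim/big_ind: _ => // [x y x0 y0|l].
    by rewrite lcmn_gt0 x0.
  by rewrite mem_filter mem_iota => /and3P [].
have o_dvd a : a < n -> o a %| L.
  move=> /oP [x ->]; have := order_cycle_lengths x pf; rewrite /L /lcm_seq.
  elim: (cycle_lengths A) => // l s IH; rewrite in_cons big_cons.
  by move=> /orP [/eqP <-|/IH h]; rewrite ?dvdn_lcml // (dvdn_trans h) // dvdn_lcmr.
have inpA x : inp (e x) = e (f x) by rewrite /inp nth_cat su ltn_ord tabA.
have inpB y : inp (n + e' y) = e' (g y).
  by rewrite /inp nth_cat su ltnNge leq_addr /= addKn tabB.
have key_lcm a x : a < n -> x < q -> lcmn (lcmn (o a) x.+1) L = lcmn x.+1 L.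
  move=> lt_a _; rewrite (lcmnC (o a)) -lcmnA; congr lcmn.
  by apply/eqP; rewrite eqn_dvd dvdn_lcm o_dvd // dvdnn dvdn_lcmr.
have le_qm := q_le n_gt0 nq_le.
apply: triple_leq.
- apply: (@triple_if_le _ _ _ _ _ _ _ 0) => /= [_|]; last by rewrite ltnNge le_nm.
  apply: triple_seq (@quotient_blockP inp (init n m) n m n_gt0 erefl erefl) _ => s1 F1 eq1.
  have en1 : vars s1 Vn = n by rewrite F1.1.
  apply: triple_seq (orders_blockP injf bije inpA oE en1) _ => s2 F2 eo2.
  have en2 : vars s2 Vn = n by rewrite F2.1.
  have em2 : vars s2 Vm = m by rewrite F2.1 // F1.1.
  have num2 k : arrs s2 Anum k = 0 by rewrite F2.2 // F1.2.
  apply: triple_seq (numbers_blockP injg bije' inpB en2 em2 num2) _ => s3 F3 eb3.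
  have E3 : env n m q o s3.
    split=> [|||a lt_a]; rewrite ?F3.1 //; last by rewrite F3.2 // eo2.
    by rewrite F2.1.
  apply: triple_seq (labels_blockP inp (key := lcmn^~ L) o_gt0 o_le n_gt0 q_gt0
    nq_le key_lcm E3) _.
  move=> s4 F4 [[lab_le lab_key] lab_j].
  have E4 := env_frame E3 F4 isT.
  apply: triple_set_seq; set s5 := setv _ _ _.
  have leW c : weight (radix q (arrs s4 Alab) c) q <= 2 * q ^ ndiv L.
    apply: leq_trans (weight_radix_le _ _ _) _.
    rewrite leq_mul2l leq_pexp2l //=.
    exact: count_lcm_class L_gt0 le_qm lab_key.
  apply: triple_weak (classes_loopP inp o_gt0 o_le n_gt0 q_gt0 nq_le
    (lab := arrs s4 Alab) (b := norder g) (s := s5) (W := 2 * q ^ ndiv L) _ _ _ _ _ _)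
    (leqnn _) _ => //.
  + by move=> k /=; rewrite F4.2 // eb3.
  + by move=> x lt_x /=; rewrite muln0 F4.2 // F3.2 // F2.2 // F1.2.
  move=> s6 _ ->; rewrite -(card_solutions _ lab_j lab_le le_qm).
  exact: (number_of_solutionsE pf pg bije oE (fun=> erefl) n_gt0).
- have W0 : 0 < q ^ ndiv L by rewrite expn_gt0 q_gt0.
  rewrite /= maxn0 -/m; move: (q ^ _) W0 => W W0.
  have hn : n.+1 * n.+1 <= m.+1 * m.+1 by rewrite leq_mul.
  have h1 : m.+1 <= m.+1 * m.+1 by rewrite leq_pmulr.
  have h2 : m.+1 * m.+1 <= m.+1 * m.+1 * m.+1 by rewrite leq_pmulr.
  have h3 : m.+1 * m.+1 * m.+1 <= m.+1 * m.+1 * m.+1 * W by rewrite leq_pmulr.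
  have h0 : 0 < m.+1 by [].
  by move: (m.+1) (n.+1) h0 h1 h2 h3 hn => M N; lia.
Qed.

(** * Conclusion *)

Import Order.TTheory GRing.Theory Num.Theory.
Local Open Scope ring_scope.

Theorem theorem1 :
  exists (p : program) (c : nat),
    forall (A B : digraph) (u v : seq nat),
      sum_of_cycles A -> sum_of_cycles B ->
      (0 < dsize A)%N -> (0 < dsize B)%N ->
      encodes A u -> encodes B v ->
      exists t k : nat,
        [/\ run p (input u v) t k,
            number_of_solutions A B k,
            (dsize A <= dsize B)%N ->
              t%:R <= c%:R * ((dsize B)%:R ^+ 3 *
                ((dsize B)%:R / (dsize A)%:R)
                  ^+ ndiv (lcm_seq (cycle_lengths A))) :> rat
          & (dsize B < dsize A)%N -> (t <= c * (dsize A + dsize B))%N].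
Proof.
(* As (m + 1)^3 <= 8 m^3, the bound of mainP is at most 64000 m^3 q^div(L). *)
exists (compile main), (65 * 1000)%N => A B u v sA sB A_gt0 B_gt0 encA encB.
have [f pf _] := sum_of_cyclesP sA; have [g pg _] := sum_of_cyclesP sB.
set d := ndiv _; exists (cost (nth 0%N (u ++ v)) main (init (size u) (size v)) + 4)%N.
exists (vars (den (nth 0%N (u ++ v)) main (init (size u) (size v))) Vres).
have [leAB|ltBA] := leqP (dsize A) (dsize B).
  have [|T sol] := mainP pf pg encA encB; first by rewrite A_gt0.
  split; [exact: run_compile | exact: sol | move=> _ | by move=> /notF []].
  set q := (dsize B %/ dsize A)%N in T; rewrite -/d in T.
  have q_gt0 : (0 < q)%N by rewrite divn_gt0.
  have le_t : (cost (nth 0%N (u ++ v)) main (init (size u) (size v)) + 4 <=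
      65 * 1000 * (dsize B ^ 3 * q ^ d))%N.
    have : (0 < q ^ d)%N by rewrite expn_gt0 q_gt0.
    move: T; move: (cost _ _ _) (q ^ d)%N (dsize B) B_gt0 => t W m m_gt0 T W_gt0.
    have m3 : (m.+1 * m.+1 * m.+1 <= 8 * m ^ 3)%N.
      by rewrite (_ : 8 * m ^ 3 = 2 * m * (2 * m) * (2 * m))%N ?leq_mul //; lia.
    have mW : (0 < m ^ 3 * W)%N by rewrite muln_gt0 expn_gt0 m_gt0.
    move: m3 mW T; move: (m ^ 3)%N => M; nia.
  apply: le_trans (_ : (65 * 1000 * (dsize B ^ 3 * q ^ d))%:R <= _).
    by rewrite ler_nat.
  rewrite [leLHS]natrM [(_ ^ 3 * _)%:R]natrM !natrX ler_wpM2l ?ler0n //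
      ler_wpM2l ?exprn_ge0 ?ler0n //.
  rewrite lerXn2r ?nnegrE ?divr_ge0 ?ler0n // ler_pdivlMr ?ltr0n //.
  by rewrite -natrM ler_nat leq_divM.
have [_ [su _]] := (encA, encA); have [sv _] := encB.
have [T eres] : triple (nth 0%N (u ++ v)) main (init (size u) (size v)) 20
    (fun s => vars s Vres = 0%N).
  apply: triple_leq.
    apply: (@triple_if_le _ _ _ _ _ _ 0 0) => [|_]; last exact: triple_skip.
    by rewrite [X in X -> _]/= su sv leqNgt ltBA.
  by [].
split; last 2 first.
- by move=> /notF [].
- move=> _; apply: leq_trans (leq_add T (leqnn 4)) _.
  by move: A_gt0 B_gt0; lia.
- exact: run_compile.
- by rewrite eres; apply: no_solution; apply/andP.
Qed.
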